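(* Let $\xi\in\mathbb{C}$ with $\mathrm{Re}(\xi)>0$, and for $b\in X$ let $$C_{\xi}(b)=\sum_{a\in X}\varepsilon_0\exp\Big(-\pi\,{}^{\star}\varepsilon\,\xi\sum_{k\in L}\big(a(k)+i\tfrac{1}{\xi}b(k)\big)^2\Big).$$ If $b\in X$ is such that there exists $b_0\in{}^{*}\mathbb{R}$ with $|b(k)|\le\star(b_0)$ for all $k\in L$, then $$\mathrm{st}(C_{\xi}(b))=\Big({}^{*}\Big(\tfrac{1}{\sqrt{\xi}}\Big)\Big)^{H^2}\in{}^{*}\mathbb{C}\quad\text{and}\quad \mathbf{st}\left(\frac{C_{\xi}(b)}{\star\Big(\big({}^{*}(\tfrac{1}{\sqrt{\xi}})\big)^{H^2}\Big)}\right)=1,$$ where $\sqrt{\xi}$ is the principal square root.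
   Context: Double nonstandard framework: $F_2$ is a nonprincipal ultrafilter on an infinite set $\Lambda_2$ and ${}^{*}S=S^{\Lambda_2}/F_2$. $F_1$ is a nonprincipal ultrafilter on an infinite set $\Lambda_1$; for a ${}^*$-internal set $S$, ${}^{\star}S$ is the ${}^*$-ultrapower of $S$ with respect to ${}^*F_1$, so ${}^{\star}({}^{*}S)=S^{\Lambda_1\times\Lambda_2}/F_1^{F_2}$; ${}^{\star}x$ or $\star(x)$ denotes the image of $x$ under this embedding, and ${}^*x$ the image of a standard $x$ in ${}^*S$. ''Internal with a double meaning'' means internal for the double ultrapower. $\mathrm{st}$ denotes the standard part map from elements of ${}^{\star}({}^{*}\mathbb{C})$ bounded in absolute value by an element of ${}^*\mathbb{R}$ to ${}^{*}\mathbb{C}$ (elements of ${}^{\star}({}^{*}\mathbb{R})$ are infinitesimal if nonzero and smaller in absolute value than every positive element of ${}^*\mathbb{R}$); $\mathbf{st}$ denotes the standard part with respect to the composite embedding $\star\circ *:\mathbb{R}\to{}^{\star}({}^{*}\mathbb{R})$, i.e. $\mathbf{st}=\mathrm{st}\circ\mathrm{st}$. Let $H\in{}^{*}\mathbb{Z}$ be a positive even infinite number and $H'\in{}^{\star}({}^{*}\mathbb{Z})$ a positive even number larger than every element of ${}^{*}\mathbb{Z}$; $\varepsilon=1/H$, $\varepsilon'=1/H'$. $L=\{\varepsilon z: z\in{}^*\mathbb{Z},\,-H/2\le\varepsilon z<H/2\}$ (size $H^2$), $L'=\{\varepsilon' z': z'\in{}^{\star}({}^{*}\mathbb{Z}),\,-{}^{\star}H\frac{H'}{2}\le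 \varepsilon' z'<{}^{\star}H\frac{H'}{2}\}$. $X$ is the set of internal (double meaning) functions from ${}^{\star}L$ to $L'$, and $\varepsilon_0=({}^{\star}H)^{-({}^{\star}H)^2/2}H'^{-({}^{\star}H)^2}$. *)

(* Defs.v *)
From HB Require Import structures.
From mathcomp Require Import all_boot all_order all_algebra generic_quotient.
From mathcomp Require Import all_classical all_reals all_analysis.
From mathcomp Require Import complex.

Set Implicit Arguments.
Unset Strict Implicit.
Unset Printing Implicit Defensive.

Import Order.TTheory GRing.Theory Num.Theory.

Local Open Scope classical_set_scope.
Local Open Scope ring_scope.
Local Open Scope quotient_scope.

Record ultrafilter (I : Type) := Ultrafilter {
  uf_sets : set_system I;
  uf_ultra : UltraFilter uf_sets }.
#[global] Existing Instance uf_ultra.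

Definition nonprincipal (I : Type) (F : ultrafilter I) : Prop :=
  forall i : I, ~ uf_sets F [set i].

Section UltrafilterProduct.
Variables (I1 I2 : Type) (F1 : ultrafilter I1) (F2 : ultrafilter I2).

Definition uprod_sets : set_system (I1 * I2) :=
  [set A | uf_sets F2 [set m | uf_sets F1 [set l | A (l, m)]]].

Lemma uprod_proper : ProperFilter uprod_sets.
Proof.
split; first by rewrite /uprod_sets/= => /filter_ex[m] /filter_ex[l].
split; rewrite /uprod_sets/=.
- by apply: filterE => m; apply: filterE.
- move=> A B /= FA FB; apply: (@filterS2 _ (uf_sets F2)) FA FB => m /=.
  by move=> Am Bm; apply: (@filterS2 _ (uf_sets F1)) Am Bm => l.
- move=> A B AB /=; apply: (@filterS _ (uf_sets F2)) => m /=.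
  by apply: (@filterS _ (uf_sets F1)) => l /=; apply: AB.
Qed.

Lemma uprod_ultra : UltraFilter uprod_sets.
Proof.
have uP := uprod_proper; split=> // G GP FG.
apply/seteqP; split=> // A GA; apply: contrapT => nFA.
have FnA : uprod_sets (~` A).
  rewrite /uprod_sets/=.
  have [//|FmC] := in_ultra_setVsetC
    [set m | uf_sets F1 [set l | A (l, m)]] (uf_ultra F2).
  apply: filterS FmC => m /= nF1.
  by have [//|] := in_ultra_setVsetC [set l | A (l, m)] (uf_ultra F1).
have /filter_ex[p []//] : G (A `&` ~` A).
by apply: filterI => //; apply: FG.
Qed.

(* The ultrafilter written F_1^{F_2}: A is large iff, for F2-almost all m,
   its section over m is F1-large. *)
Definition uprod : ultrafilter (I1 * I2) := Ultrafilter uprod_ultra.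

End UltrafilterProduct.

Section Ultrapower.
Variables (I : Type) (F : ultrafilter I).

Section Carrier.
Variable T : Type.
Implicit Types f g : I -> {classic T}.

Definition ueq f g : bool := `[< uf_sets F [set i | f i = g i] >].

Lemma ueq_refl : reflexive ueq.
Proof. by move=> f; apply/asboolP; apply: filterE. Qed.

Lemma ueq_sym : symmetric ueq.
Proof. by move=> f g; apply/asboolP/asboolP; apply: filterS => i /= ->. Qed.

Lemma ueq_trans : transitive ueq.
Proof.
move=> g f h /asboolP fg /asboolP gh; apply/asboolP.
by apply: filterS2 fg gh => i /= -> ->.
Qed.

Canonical ueq_equiv := EquivRel ueq ueq_refl ueq_sym ueq_trans.

Definition ultrapower : Type := {eq_quot ueq_equiv}.
HB.instance Definition _ := Choice.on ultrapower.

Definition ucl (f : I -> T) : ultrapower := \pi_{eq_quot ueq_equiv} f.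
Definition urep (x : ultrapower) : I -> T := repr (x : {eq_quot ueq_equiv}).
Definition ucst (t : T) : ultrapower := ucl (fun=> t).

Lemma urepK (x : ultrapower) : ucl (urep x) = x.
Proof. exact: reprK. Qed.

Lemma uclP (f g : I -> T) : ucl f = ucl g <-> uf_sets F [set i | f i = g i].
Proof.
split=> [/eqP|fg]; last by apply/eqP; rewrite eqmodE; apply/asboolP.
by rewrite eqmodE => /asboolP.
Qed.

Lemma urep_ucl (f : I -> T) : uf_sets F [set i | urep (ucl f) i = f i].
Proof. by apply/uclP; rewrite urepK. Qed.

Lemma uclW (P : ultrapower -> Prop) : (forall f, P (ucl f)) -> forall x, P x.
Proof. by move=> Pucl x; rewrite -(urepK x). Qed.

End Carrier.

Section Lifting.
Variables T U V : Type.

Definition umap (f : T -> U) (x : ultrapower T) : ultrapower U :=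
  ucl (fun i => f (urep x i)).

Definition umap2 (f : T -> U -> V) (x : ultrapower T) (y : ultrapower U) :
    ultrapower V :=
  ucl (fun i => f (urep x i) (urep y i)).

Definition urel (P : T -> U -> Prop) (x : ultrapower T) (y : ultrapower U) :
    Prop :=
  uf_sets F [set i | P (urep x i) (urep y i)].

Lemma umapE f (x : I -> T) : umap f (ucl x) = ucl (fun i => f (x i)).
Proof. by apply/uclP; apply: filterS (urep_ucl x) => i /= ->. Qed.

Lemma umap2E f (x : I -> T) (y : I -> U) :
  umap2 f (ucl x) (ucl y) = ucl (fun i => f (x i) (y i)).
Proof.
by apply/uclP; apply: filterS2 (urep_ucl x) (urep_ucl y) => i /= -> ->.
Qed.

Lemma urelE P (x : I -> T) (y : I -> U) :
  urel P (ucl x) (ucl y) <-> uf_sets F [set i | P (x i) (y i)].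
Proof.
split; rewrite /urel; apply: filterS3 (urep_ucl x) (urep_ucl y) => i /=.
  by move=> -> ->.
by move=> -> ->.
Qed.

End Lifting.

Lemma uf_meet (A B : set I) : uf_sets F A -> uf_sets F B ->
  exists i, A i /\ B i.
Proof. by move=> FA FB; apply: (@filter_ex _ (uf_sets F)); apply: filterI. Qed.

Lemma uf_not (A : set I) : ~ uf_sets F A <-> uf_sets F (~` A).
Proof.
split=> [nA|FnA FA]; first by have [] := in_ultra_setVsetC A (uf_ultra F).
by have [i []] := uf_meet FA FnA.
Qed.

Lemma uf_or (A B : set I) : uf_sets F (A `|` B) -> uf_sets F A \/ uf_sets F B.
Proof.
move=> FAB; have [|/uf_not nA] := pselect (uf_sets F A); first by left.
by right; apply: filterS2 FAB nA => i [].
Qed.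

Section Zmod.
Variable T : zmodType.

Lemma uaddA : associative (umap2 (@GRing.add T)).
Proof.
elim/uclW=> x; elim/uclW=> y; elim/uclW=> z; rewrite !umap2E.
by apply/uclP; apply: filterE => i /=; rewrite addrA.
Qed.

Lemma uaddC : commutative (umap2 (@GRing.add T)).
Proof.
elim/uclW=> x; elim/uclW=> y; rewrite !umap2E.
by apply/uclP; apply: filterE => i /=; rewrite addrC.
Qed.

Lemma uadd0 : left_id (ucst 0) (umap2 (@GRing.add T)).
Proof.
elim/uclW=> x; rewrite !umap2E.
by apply/uclP; apply: filterE => i /=; rewrite add0r.
Qed.

Lemma uaddN : left_inverse (ucst 0) (umap (@GRing.opp T))
  (umap2 (@GRing.add T)).
Proof.
elim/uclW=> x; rewrite umapE umap2E.
by apply/uclP; apply: filterE => i /=; rewrite addNr.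
Qed.

HB.instance Definition _ :=
  GRing.isZmodule.Build (ultrapower T) uaddA uaddC uadd0 uaddN.

End Zmod.

Section ComRing.
Variable T : comNzRingType.

Lemma umulA : associative (umap2 (@GRing.mul T)).
Proof.
elim/uclW=> x; elim/uclW=> y; elim/uclW=> z; rewrite !umap2E.
by apply/uclP; apply: filterE => i /=; rewrite mulrA.
Qed.

Lemma umulC : commutative (umap2 (@GRing.mul T)).
Proof.
elim/uclW=> x; elim/uclW=> y; rewrite !umap2E.
by apply/uclP; apply: filterE => i /=; rewrite mulrC.
Qed.

Lemma umul1 : left_id (ucst 1) (umap2 (@GRing.mul T)).
Proof.
elim/uclW=> x; rewrite !umap2E.
by apply/uclP; apply: filterE => i /=; rewrite mul1r.
Qed.

Lemma umulDl : left_distributive (umap2 (@GRing.mul T)) (+%R).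
Proof.
elim/uclW=> x; elim/uclW=> y; elim/uclW=> z; rewrite /GRing.add/= !umap2E.
by apply/uclP; apply: filterE => i /=; rewrite mulrDl.
Qed.

Lemma uone_neq0 : ucst 1 != 0 :> ultrapower T.
Proof.
apply/eqP => /uclP/filter_ex[i /=] /eqP.
by rewrite oner_eq0.
Qed.

HB.instance Definition _ := GRing.Zmodule_isComNzRing.Build (ultrapower T)
  umulA umulC umul1 umulDl uone_neq0.

End ComRing.

Section RingE.

Lemma uadd_ucl (T : zmodType) (x y : I -> T) :
  ucl x + ucl y = ucl (fun i => x i + y i).
Proof. exact: umap2E. Qed.

Lemma uopp_ucl (T : zmodType) (x : I -> T) : - ucl x = ucl (fun i => - x i).
Proof. exact: umapE. Qed.

Lemma usub_ucl (T : zmodType) (x y : I -> T) :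
  ucl x - ucl y = ucl (fun i => x i - y i).
Proof. by rewrite uopp_ucl uadd_ucl. Qed.

Lemma umul_ucl (T : comNzRingType) (x y : I -> T) :
  ucl x * ucl y = ucl (fun i => x i * y i).
Proof. exact: umap2E. Qed.

Lemma uexp_ucl (T : comNzRingType) (x : I -> T) n :
  ucl x ^+ n = ucl (fun i => x i ^+ n).
Proof.
elim: n => [//|n IHn]; rewrite exprS IHn umul_ucl.
by apply/uclP; apply: filterE => i /=; rewrite exprS.
Qed.

End RingE.

Section ComUnitRing.
Variable T : comUnitRingType.

Definition uunit : {pred ultrapower T} :=
  fun x => `[< uf_sets F [set i | urep x i \is a GRing.unit] >].

Lemma uunitE (x : I -> T) :
  ucl x \in uunit <-> uf_sets F [set i | x i \is a GRing.unit].
Proof.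
split=> [/asboolP Fx|Fx].
  by apply: filterS2 (urep_ucl x) Fx => i /= ->.
by apply/asboolP; apply: filterS2 (urep_ucl x) Fx => i /= ->.
Qed.

Lemma umulVx : {in uunit, left_inverse 1 (umap (@GRing.inv T)) *%R}.
Proof.
elim/uclW=> x /uunitE Fx; rewrite umapE umul_ucl.
by apply/uclP; apply: filterS Fx => i /= xu; rewrite mulVr.
Qed.

Lemma uunitPl (x y : ultrapower T) : y * x = 1 -> uunit x.
Proof.
elim/uclW: x => x; elim/uclW: y => y; rewrite umul_ucl => /uclP Fxy.
apply/uunitE; apply: filterS Fxy => i /= yx1.
by apply/unitrPr; exists (y i); rewrite mulrC.
Qed.

Lemma uinv_out : {in [predC uunit], umap (@GRing.inv T) =1 id}.
Proof.
elim/uclW=> x; rewrite inE => /negP /uunitE /uf_not Fx; rewrite umapE.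
by apply/uclP; apply: filterS Fx => i /= /negP xu; rewrite invr_out.
Qed.

HB.instance Definition _ :=
  GRing.ComNzRing_hasMulInverse.Build (ultrapower T) umulVx uunitPl uinv_out.

Lemma uinv_ucl (x : I -> T) : (ucl x)^-1 = ucl (fun i => (x i)^-1).
Proof. exact: umapE. Qed.

End ComUnitRing.

Section Idomain.
Variable T : idomainType.

Lemma umul_eq0 : GRing.integral_domain_axiom (ultrapower T).
Proof.
elim/uclW=> x; elim/uclW=> y; rewrite umul_ucl => /uclP Fxy; apply/orP.
have /uf_or[Fx|Fy] :
    uf_sets F ([set i | x i = 0] `|` [set i | y i = 0]).
- apply: filterS Fxy => i /= /eqP; rewrite mulf_eq0 => /orP[] /eqP; tauto.
- by left; apply/eqP/uclP.
- by right; apply/eqP/uclP.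
Qed.

HB.instance Definition _ :=
  GRing.ComUnitRing_isIntegral.Build (ultrapower T) umul_eq0.

End Idomain.

Section Field.
Variable T : fieldType.

Lemma ufieldP : GRing.field_axiom (ultrapower T).
Proof.
elim/uclW=> x /eqP x0; apply/uunitE.
have /uf_not : ~ uf_sets F [set i | x i = 0] by move=> /uclP.
by apply: filterS => i /= nx0; rewrite unitfE; apply/eqP.
Qed.

HB.instance Definition _ :=
  GRing.UnitRing_isField.Build (ultrapower T) ufieldP.

End Field.

Section NumDomain.
Variable T : numDomainType.

Definition ule : rel (ultrapower T) :=
  fun x y => `[< urel (fun s t => s <= t) x y >].
Definition ult : rel (ultrapower T) :=
  fun x y => `[< urel (fun s t => s < t) x y >].

Lemma uleP (x y : I -> T) :
  ule (ucl x) (ucl y) <-> uf_sets F [set i | x i <= y i].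
Proof. by split=> [/asboolP/urelE|Fxy] //; apply/asboolP/urelE. Qed.

Lemma ultP (x y : I -> T) :
  ult (ucl x) (ucl y) <-> uf_sets F [set i | x i < y i].
Proof. by split=> [/asboolP/urelE|Fxy] //; apply/asboolP/urelE. Qed.

Let unorm (x : ultrapower T) := umap (fun t : T => `|t|) x.

Lemma unormD (x y : ultrapower T) : ule (unorm (x + y)) (unorm x + unorm y).
Proof.
elim/uclW: x => x; elim/uclW: y => y; rewrite /unorm uadd_ucl !umapE uadd_ucl.
by apply/uleP; apply: filterE => i /=; apply: ler_normD.
Qed.

Lemma uadd_gt0 (x y : ultrapower T) : ult 0 x -> ult 0 y -> ult 0 (x + y).
Proof.
elim/uclW: x => x; elim/uclW: y => y /ultP x0 /ultP y0.
rewrite uadd_ucl; apply/ultP; apply: filterS2 x0 y0 => i /=.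
exact: addr_gt0.
Qed.

Lemma unorm_eq0 (x : ultrapower T) : unorm x = 0 -> x = 0.
Proof.
elim/uclW: x => x; rewrite /unorm umapE => /uclP Fx; apply/uclP.
by apply: filterS Fx => i /= /normr0P/eqP.
Qed.

Lemma uge_total (x y : ultrapower T) :
  ule 0 x -> ule 0 y -> ule x y || ule y x.
Proof.
elim/uclW: x => x; elim/uclW: y => y /uleP x0 /uleP y0; apply/orP.
have /uf_or[|] : uf_sets F
    ([set i | x i <= y i] `|` [set i | y i <= x i]).
- apply: filterS2 x0 y0 => i /= xi yi; apply/orP.
  exact: ger_leVge.
- by move=> /uleP; left.
- by move=> /uleP; right.
Qed.

Lemma unormM : {morph unorm : x y / x * y}.
Proof.
elim/uclW=> x; elim/uclW=> y; rewrite /unorm umul_ucl !umapE umul_ucl.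
by apply/uclP; apply: filterE => i /=; rewrite normrM.
Qed.

Lemma ule_def (x y : ultrapower T) : ule x y = (unorm (y - x) == y - x).
Proof.
elim/uclW: x => x; elim/uclW: y => y; rewrite /unorm usub_ucl umapE.
apply/idP/eqP => [/uleP Fxy|/uclP Fxy].
  by apply/uclP; apply: filterS Fxy => i /= xy; rewrite ger0_norm// subr_ge0.
apply/uleP; apply: filterS Fxy => i /= xy.
by rewrite -subr_ge0 -xy.
Qed.

Lemma ult_def (x y : ultrapower T) : ult x y = (y != x) && ule x y.
Proof.
elim/uclW: x => x; elim/uclW: y => y; apply/idP/andP => [/ultP xy|[/eqP]].
  split; last by apply/uleP; apply: filterS xy => i /= /ltW.
  apply/eqP => /uclP yx; have [i /= []] := uf_meet xy yx.
  by move=> /[swap] ->; rewrite ltxx.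
move=> nyx /uleP xy; apply/ultP.
have /uf_not nyx' : ~ uf_sets F [set i | y i = x i] by move=> /uclP.
apply: filterS2 xy nyx' => i /= xyi yxi.
by rewrite lt_neqAle xyi andbT; apply/eqP => /esym.
Qed.

HB.instance Definition _ := Num.IntegralDomain_isNumRing.Build (ultrapower T)
  unormD uadd_gt0 unorm_eq0 uge_total unormM ule_def ult_def.

Lemma ule_ucl (x y : I -> T) :
  ucl x <= ucl y <-> uf_sets F [set i | x i <= y i].
Proof. exact: uleP. Qed.

Lemma ult_ucl (x y : I -> T) :
  ucl x < ucl y <-> uf_sets F [set i | x i < y i].
Proof. exact: ultP. Qed.

Lemma unorm_ucl (x : I -> T) : `|ucl x| = ucl (fun i => `|x i|).
Proof. exact: umapE. Qed.

End NumDomain.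

Section RealDomain.
Variable T : realDomainType.

Lemma ureal : Num.real_axiom (ultrapower T).
Proof.
elim/uclW=> x; apply/orP.
have /uf_or[|] : uf_sets F ([set i | 0 <= x i] `|` [set i | x i <= 0]).
- by apply: filterE => i /=; apply/orP; apply: le_total.
- by move=> /ule_ucl; left.
- by move=> /ule_ucl; right.
Qed.

HB.instance Definition _ := Num.NumDomain_isReal.Build (ultrapower T) ureal.

End RealDomain.

(* An internal function is an element of the ultrapower of a function space,
   an internal set one of the ultrapower of a powerset. *)
Definition uapp (T U : Type) (a : ultrapower (T -> U)) (x : ultrapower T) :
    ultrapower U :=
  umap2 (fun f t => f t) a x.

Definition uext (T : Type) (A : ultrapower (set T)) : set (ultrapower T) :=
  [set x | urel (fun t S => S t) x A].

Lemma uapp_ucl (T U : Type) (f : I -> T -> U) (x : I -> T) :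
  uapp (ucl f) (ucl x) = ucl (fun i => f i (x i)).
Proof. exact: umap2E. Qed.

Lemma uext_ucl (T : Type) (S : I -> set T) (x : I -> T) :
  uext (ucl S) (ucl x) <-> uf_sets F [set i | S i (x i)].
Proof. exact: urelE. Qed.

Lemma uext_sub (T : Type) (P Q : I -> set T) :
  uext (ucl P) `<=` uext (ucl Q) <-> uf_sets F [set i | P i `<=` Q i].
Proof.
split=> [|FPQ]; last first.
  elim/uclW=> x /uext_ucl Px; apply/uext_ucl.
  by apply: filterS2 FPQ Px => i /=; apply.
move=> PQ; apply: contrapT => /uf_not nsub.
have /choice[t tP] : forall i, exists t : option T,
    ~ (P i `<=` Q i) -> exists u, t = Some u /\ P i u /\ ~ Q i u.
  move=> i; have [|nPQ] := pselect (P i `<=` Q i); first by exists None.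
  have [u [Pu nQu]] : exists u, P i u /\ ~ Q i u.
    apply: contrapT => nex; apply: nPQ => u Pu; apply: contrapT => nQu.
    by apply: nex; exists u.
  by exists (Some u) => _; exists u.
have [i0 /= /tP[u0 _]] := filter_ex nsub.
pose x i := odflt u0 (t i).
have /PQ/uext_ucl Qx : uext (ucl P) (ucl x).
  apply/uext_ucl; apply: filterS nsub => i /= /tP[u [tu [Pu _]]].
  by rewrite /x tu.
have [i /= [/tP[u [tu [_ nQu]]]]] := uf_meet nsub Qx.
by rewrite /x tu.
Qed.

Section HyperfiniteSum.
Variables (T : choiceType) (V : zmodType).

(* s is the internal sum of g over the hyperfinite internal set A, on which g
   is internal. *)
Definition is_hsum (A : set (ultrapower T)) (g : ultrapower T -> ultrapower V)
    (s : ultrapower V) : Prop :=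
  exists (S : I -> set T) (f : I -> T -> V),
    [/\ forall i, finite_set (S i),
        A = uext (ucl S),
        forall x, A x -> g x = uapp (ucl f) x
      & s = ucl (fun i => \sum_(t \in S i) f i t)].

Definition hsum (A : set (ultrapower T)) (g : ultrapower T -> ultrapower V) :
    ultrapower V :=
  xget 0 [set s | is_hsum A g s].

Lemma is_hsum_uniq A g s s' : is_hsum A g s -> is_hsum A g s' -> s = s'.
Proof.
move=> [S [f [finS AS gf ->]]] [S' [f' [finS' AS' gf' ->]]]; apply/uclP.
have SS' : uf_sets F [set i | S i = S' i].
  have s1 : uf_sets F [set i | S i `<=` S' i] by apply/uext_sub; rewrite -AS AS'.
  have s2 : uf_sets F [set i | S' i `<=` S i] by apply/uext_sub; rewrite -AS' AS.
  by apply: filterS2 s1 s2 => i /= ? ?; apply/seteqP.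
have ff' : uf_sets F [set i | forall t, S i t -> f i t = f' i t].
  have : uext (ucl S) `<=` uext (ucl (fun i => [set t | f i t = f' i t])).
    elim/uclW => x; rewrite -AS => Ax; apply/uext_ucl.
    by move: (gf _ Ax); rewrite (gf' _ Ax) !uapp_ucl => /uclP; apply: filterS.
  by move=> /uext_sub.
apply: filterS2 SS' ff' => i /= <- ff'; apply: eq_fsbigr => t.
by rewrite inE => /ff'.
Qed.

Lemma hsumE A g s : is_hsum A g s -> hsum A g = s.
Proof.
move=> gs; apply: is_hsum_uniq (gs).
by apply: (@xgetPex _ 0 [set s | is_hsum A g s]); exists s.
Qed.

End HyperfiniteSum.

End Ultrapower.

Section DoubleNonstandard.
Variables (I1 I2 : Type) (F1 : ultrafilter I1) (F2 : ultrafilter I2).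

Definition ustar (T : Type) (x : ultrapower F2 T) :
    ultrapower (uprod F1 F2) T :=
  ucl (uprod F1 F2) (fun p => urep x p.2).

Lemma ustar_ucl (T : Type) (x : I2 -> T) :
  ustar (ucl F2 x) = ucl (uprod F1 F2) (fun p => x p.2).
Proof.
apply/uclP; apply: filterS (urep_ucl F2 x) => m /= xm.
exact: filterE.
Qed.

Definition dstd (T : Type) (t : T) : ultrapower (uprod F1 F2) T :=
  ustar (ucst F2 t).

(* The *-ultrapower of A with respect to *F1: the classes of the internal
   functions from *I1 to A. The class of f : I1 * I2 -> T corresponds to the
   internal function sending the class of l : I2 -> I1 to the class of
   m |-> f (l m, m). *)
Definition ustar_set (T : Type) (A : set (ultrapower F2 T)) :
    set (ultrapower (uprod F1 F2) T) :=
  [set x | exists f : I1 * I2 -> T,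
     x = ucl (uprod F1 F2) f /\
     forall l : I2 -> I1, A (ucl F2 (fun m => f (l m, m)))].

End DoubleNonstandard.
Arguments ustar {I1 I2} F1 {F2 T} x.
Arguments dstd {I1 I2} F1 F2 {T} t.
Arguments ustar_set {I1 I2} F1 {F2 T} A.

Definition hR (R : realType) (I : Type) (F : ultrafilter I) :
  ultrapower F int -> ultrapower F R := umap (fun z : int => z%:~R).
Definition hC (R : realType) (I : Type) (F : ultrafilter I) :
  ultrapower F R -> ultrapower F R[i] := umap (fun x : R => x%:C%C).
Definition hnormc (R : realType) (I : Type) (F : ultrafilter I) :
  ultrapower F R[i] -> ultrapower F R := umap (@ComplexField.Normc.normc R).

Definition cexp (R : realType) (z : R[i]) : R[i] :=
  ((expR (complex.Re z))%:C * (cos (complex.Im z) +i* sin (complex.Im z)))%C.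
Definition hcexp (R : realType) (I : Type) (F : ultrafilter I) :
  ultrapower F R[i] -> ultrapower F R[i] := umap (@cexp R).

Definition hpowR (R : realType) (I : Type) (F : ultrafilter I) :
  ultrapower F R -> ultrapower F R -> ultrapower F R := umap2 (@powR R).
Definition hexprz (T : unitRingType) (I : Type) (F : ultrafilter I) :
  ultrapower F T -> ultrapower F int -> ultrapower F T := umap2 (@exprz T).

Section StandardPart.
Variables (R : realType) (I1 I2 : Type).
Variables (F1 : ultrafilter I1) (F2 : ultrafilter I2).
Implicit Types x : ultrapower (uprod F1 F2) R[i].

Definition star_bounded x : Prop :=
  exists r : ultrapower F2 R, hnormc x <= ustar F1 r.

(* st and bst take the junk value 0 outside their domains, which are
   star_bounded and std_bounded. *)
Definition st x : ultrapower F2 R[i] :=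
  xget 0 [set y | forall d : ultrapower F2 R, 0 < d ->
                    hnormc (x - ustar F1 y) < ustar F1 d].

Definition std_bounded x : Prop := exists r : R, hnormc x <= dstd F1 F2 r.

Definition bst x : R[i] :=
  xget 0 [set y | forall d : R, 0 < d ->
                    hnormc (x - dstd F1 F2 y) < dstd F1 F2 d].

End StandardPart.

Section Lattices.
Variables (R : realType) (I1 I2 : Type).
Variables (F1 : ultrafilter I1) (F2 : ultrafilter I2).
Variables (H : ultrapower F2 int) (H' : ultrapower (uprod F1 F2) int).

Local Notation RR := (ultrapower (uprod F1 F2) R).
Local Notation CC := (ultrapower (uprod F1 F2) R[i]).

Definition eps : ultrapower F2 R := (hR R H)^-1.
Definition eps' : RR := (hR R H')^-1.
Definition sH : RR := hR R (ustar F1 H).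

Definition latL : set (ultrapower F2 R) :=
  [set x | exists z : ultrapower F2 int,
     x = eps * hR R z /\ - (hR R H / 2) <= x < hR R H / 2].

Definition latL' : set RR :=
  [set x | exists z : ultrapower (uprod F1 F2) int,
     x = eps' * hR R z /\
     - (sH * (hR R H' / 2)) <= x < sH * (hR R H' / 2)].

Definition starL : set RR := ustar_set F1 latL.

(* An internal function from starL to L' is represented by its extension by 0
   to an internal function on the double ultrapower of R. *)
Definition Xset : set (ultrapower (uprod F1 F2) (R -> R)) :=
  [set a | (forall k, starL k -> latL' (uapp a k)) /\
           (forall k, ~ starL k -> uapp a k = 0)].

Definition eps0 : RR :=
  hpowR sH (- (sH ^+ 2) / 2) * hpowR (hR R H') (- sH ^+ 2).

Definition Cxi (xi : R[i]) (b : ultrapower (uprod F1 F2) (R -> R)) : CC :=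
  hsum Xset (fun a =>
    hC eps0 *
    hcexp (- (hC (dstd F1 F2 (pi : R)) * hC (ustar F1 eps) * dstd F1 F2 xi *
      hsum starL (fun k =>
        (hC (uapp a k) + dstd F1 F2 ('i%C * xi^-1) * hC (uapp b k)) ^+ 2)))).

End Lattices.

(* Main.v *)
Require Import Defs.
From mathcomp Require Import all_boot all_order all_algebra.
From mathcomp Require Import all_classical all_reals all_analysis complex.
From mathcomp Require Import ring lra.

(* Over a fixed index m of F2 the set L is a fixed finite grid, and C factors
   as a product, over the points k of that grid, of one-dimensional Riemann sums
   of a complex Gaussian whose mesh 1/H' tends to 0 and whose range tends to
   the whole line along F1. Each factor therefore tends to 1/sqrt(xi), uniformly
   in |b(k)| <= b0, and so does the finite product to its power; a choice of
   representatives turns this fibrewise convergence into the two statements on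
   standard parts.

   The limit of the Riemann sums is obtained without complex integration. The
   line x |-> w x + g (w proportional to sqrt(xi)) is joined to the real line by
   x |-> W x + G with (W, G) linear in a parameter s, and
     d/ds (W e^{-(W x + G)^2}) = d/dx ((W' x + G') e^{-(W x + G)^2}).
   The sum over the grid of the right-hand side telescopes up to O(mesh), hence
   the Riemann sum is almost independent of s, and at the real line it is
   compared with the Gaussian integral. *)

Set Implicit Arguments.
Unset Strict Implicit.
Unset Printing Implicit Defensive.

Import Order.TTheory GRing.Theory Num.Theory.
Import numFieldNormedType.Exports ComplexField.Normc.
Local Open Scope classical_set_scope.
Local Open Scope ring_scope.

(** * The complex exponential *)

Section ComplexExponential.
Variable R : realType.
Implicit Types (x y : R) (z w v : R[i]).

Lemma normc_ge0 z : 0 <= normc z.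
Proof. by case: z => a b; apply: sqrtr_ge0. Qed.

Lemma normcD z w : normc (z + w) <= normc z + normc w.
Proof. exact: (@le_normcD R z w). Qed.

Lemma normc_opp z : normc (- z) = normc z.
Proof. exact: (@normcN R z). Qed.

Lemma normcB z w : normc (z - w) <= normc z + normc w.
Proof. by rewrite -(normc_opp w); apply: normcD. Qed.

Lemma normc_sum (I : Type) (r : seq I) (P : pred I) (F : I -> R[i]) :
  normc (\sum_(i <- r | P i) F i) <= \sum_(i <- r | P i) normc (F i).
Proof.
elim/big_ind2: _ => // [|z a w b za wb]; first by rewrite normc0.
exact: le_trans (normcD _ _) (lerD za wb).
Qed.

Lemma normcR x : normc x%:C%C = `|x|.
Proof. by rewrite /normc /= expr0n /= addr0 sqrtr_sqr. Qed.

Lemma normcX z n : normc (z ^+ n) = normc z ^+ n.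
Proof.
by elim: n => [|n IHn]; rewrite ?expr0 ?normc1// !exprS normcM IHn.
Qed.

Lemma normc_Re z : `|complex.Re z| <= normc z.
Proof.
case: z => a b /=; rewrite -sqrtr_sqr ler_wsqrtr// lerDl.
exact: sqr_ge0.
Qed.

Lemma normc_Im z : `|complex.Im z| <= normc z.
Proof.
case: z => a b /=; rewrite -sqrtr_sqr ler_wsqrtr// lerDr.
exact: sqr_ge0.
Qed.

Lemma normc_le_ReIm z : normc z <= `|complex.Re z| + `|complex.Im z|.
Proof.
case: z => a b /=; rewrite -(ger0_norm (addr_ge0 (normr_ge0 a) (normr_ge0 b))).
rewrite -sqrtr_sqr ler_wsqrtr// sqrrD !real_normK ?num_real//.
by rewrite addrAC lerDl mulrn_wge0 ?mulr_ge0.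
Qed.

Lemma cexpD z w : cexp (z + w) = cexp z * cexp w.
Proof.
case: z w => [a b] [c d]; rewrite /cexp /= expRD sinD cosD.
apply/eqP; rewrite eq_complex /=; apply/andP.
by split; apply/eqP; rewrite !mul0r !subr0 !addr0; ring.
Qed.

Lemma cexp0 : cexp (0 : R[i]) = 1.
Proof. by rewrite /cexp /= expR0 cos0 sin0 mul1r. Qed.

Lemma cexp_sum (I : Type) (r : seq I) (P : pred I) (F : I -> R[i]) :
  cexp (\sum_(i <- r | P i) F i) = \prod_(i <- r | P i) cexp (F i).
Proof. by apply: (big_morph (@cexp R) cexpD cexp0). Qed.

Lemma normc_cexp z : normc (cexp z) = expR (complex.Re z).
Proof.
rewrite /cexp normcM normcR ger0_norm ?expR_ge0//= cos2Dsin2 sqrtr1.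
by rewrite mulr1.
Qed.

Lemma abs_sin_le x : `|sin x| <= `|x|.
Proof.
wlog x0 : x / 0 <= x => [wlg|].
  have [/wlg//|x0] := leP 0 x.
  by rewrite -[leLHS]normrN -sinN -[leRHS]normrN wlg// oppr_ge0 ltW.
have [c _] := MVT_segment x0 (fun y _ => @is_derive_sin R y)
  (continuous_subspaceT (@continuous_sin R)).
rewrite sin0 !subr0 => ->; rewrite normrM ler_piMl//.
exact: cos_max.
Qed.

Lemma cos_sub1_sqr x : `|cos x - 1| <= x ^+ 2.
Proof.
have -> : cos x - 1 = - (2 * sin (x / 2) ^+ 2).
  have {1}-> : x = (x / 2) *+ 2 by rewrite -mulr_natr divfK.
  by rewrite cos_mulr2n cos2sin2; ring.
rewrite normrN ger0_norm; last by rewrite mulr_ge0 // sqr_ge0.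
have : sin (x / 2) ^+ 2 <= (x / 2) ^+ 2.
  rewrite -[leLHS]real_normK ?num_real// -[leRHS]real_normK ?num_real//.
  by rewrite lerXn2r ?nnegrE ?abs_sin_le.
have -> : (x / 2) ^+ 2 = x ^+ 2 / 4 by field.
by have := sqr_ge0 x; lra.
Qed.

Lemma cos_sub1_abs x : `|cos x - 1| <= 2 * `|x|.
Proof.
have [x1|x1] := leP `|x| 1; last first.
  apply: (@le_trans _ _ 2); last by lra.
  by rewrite ler_norml; have := cos_geN1 x; have := cos_le1 x; lra.
apply: le_trans (cos_sub1_sqr x) _.
by rewrite -real_normK ?num_real// expr2 ler_wpM2r//; lra.
Qed.

Lemma sin_subx_sqr x : `|sin x - x| <= 2 * x ^+ 2.
Proof.
wlog x0 : x / 0 <= x => [wlg|].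
  have [/wlg//|x0] := leP 0 x.
  have := wlg (- x); rewrite sinN sqrrN opprK addrC -opprB normrN.
  by apply; rewrite oppr_ge0 ltW.
have dsin (y : R) : y \in `]0, x[ ->
    is_derive y 1 (fun x => sin x - x) (cos y - 1).
  by move=> _; apply: is_deriveB.
have csin : {within `[0, x], continuous (fun x : R => sin x - x)}.
  apply: continuous_subspaceT => y; apply: cvgB; last exact: cvg_id.
  exact: continuous_sin.
have [c cx] := MVT_segment x0 dsin csin.
rewrite sin0 !subr0 => ->; rewrite normrM (ger0_norm x0).
rewrite expr2 mulrA ler_wpM2r//; apply: le_trans (cos_sub1_abs c) _.
move: cx; rewrite in_itv /= => /andP[c0 cx].
by rewrite ger0_norm// ler_wpM2l.
Qed.

Lemma expR_sub1_le x : expR x - 1 <= x * expR x.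
Proof.
have := expR_ge1Dx (- x); rewrite expRN => h.
have e0 := expR_gt0 x.
have : (1 - x) * expR x <= 1 by rewrite -ler_pdivlMr// div1r.
by rewrite mulrBl mul1r; lra.
Qed.

Lemma abs_expR_sub1 x : `|expR x - 1| <= `|x| * expR `|x|.
Proof.
have [x0|x0] := leP 0 x.
  rewrite (ger0_norm x0) ger0_norm ?expR_sub1_le// subr_ge0.
  by apply: le_trans (expR_ge1Dx x); rewrite lerDl.
rewrite ltr0_norm; last by rewrite subr_lt0 expR_lt1.
apply: (@le_trans _ _ (- x)); first by have := expR_ge1Dx x; lra.
rewrite (ltr0_norm x0) ler_peMr ?oppr_ge0 ?(ltW x0)// -expR0 ler_expR.
by lra.
Qed.

Lemma abs_expR_sub1x x : `|expR x - 1 - x| <= x ^+ 2 * expR `|x|.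
Proof.
rewrite ger0_norm; last by have := expR_ge1Dx x; lra.
apply: (@le_trans _ _ (x * (expR x - 1))).
  by have := expR_sub1_le x; lra.
apply: le_trans (ler_norm _) _; rewrite normrM.
rewrite -[x ^+ 2]real_normK ?num_real// expr2 -mulrA ler_wpM2l//.
exact: abs_expR_sub1.
Qed.

(** The real and imaginary parts split into four terms, each of second order in [normc v]; their
    constants 1, 1, 2 and 1 add up to 5. *)
Lemma cexp_taylor v :
  normc (cexp v - 1 - v) <= 5 * (normc v ^+ 2 * expR (normc v)).
Proof.
set r := normc v; set x := complex.Re v; set y := complex.Im v.
have r0 : 0 <= r := normc_ge0 v.
have xr : `|x| <= r := normc_Re v.
have yr : `|y| <= r := normc_Im v.
set E := expR r; have E0 : 0 <= E := expR_ge0 r.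
have xE : expR `|x| <= E by rewrite ler_expR.
have eE : `|expR x| <= E.
  by rewrite ger0_norm ?expR_ge0// (le_trans _ xE)// ler_expR ler_norm.
have sq (t : R) : `|t| <= r -> t ^+ 2 <= r ^+ 2.
  by move=> tr; rewrite -real_normK ?num_real// lerXn2r ?nnegrE.
have -> : cexp v - 1 - v =
    ((expR x * (cos y - 1) + (expR x - 1 - x)) +i*
     (expR x * (sin y - y) + y * (expR x - 1)))%C.
  rewrite /x /y; case: v {r x y r0 xr yr E E0 xE eE sq} => a b.
  rewrite /cexp /=; apply/eqP; rewrite eq_complex /=.
  by apply/andP; split; apply/eqP; rewrite !mul0r ?subr0 ?addr0; ring.
apply: le_trans (normc_le_ReIm _) _ => /=.
have h1 : `|expR x * (cos y - 1)| <= E * r ^+ 2.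
  by rewrite normrM ler_pM// (le_trans (cos_sub1_sqr y))// sq.
have h2 : `|expR x - 1 - x| <= r ^+ 2 * E.
  by apply: le_trans (abs_expR_sub1x x) _; rewrite ler_pM ?sqr_ge0 ?expR_ge0 ?sq.
have h3 : `|expR x * (sin y - y)| <= E * (2 * r ^+ 2).
  rewrite normrM ler_pM// (le_trans (sin_subx_sqr y))// ler_wpM2l//.
  exact: sq.
have h4 : `|y * (expR x - 1)| <= r * (r * E).
  by rewrite normrM ler_pM// (le_trans (abs_expR_sub1 x))// ler_pM ?expR_ge0.
apply: le_trans (lerD (ler_normD _ _) (ler_normD _ _)) _.
apply: le_trans (lerD (lerD h1 h2) (lerD h3 h4)) _.
by rewrite le_eqVlt; apply/orP; left; apply/eqP; ring.
Qed.

End ComplexExponential.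

(** * Riemann sums of complex Gaussians *)

Section GaussianPath.
Variable R : realType.
Implicit Types (x s t c y : R) (z A k d : R[i]).

Definition cgauss z : R[i] := cexp (- z ^+ 2).

(* Growth factor of the second-order remainder in [cgauss_step]. *)
Definition step_bound c y : R := 94 * c ^+ 5 * expR ((3 * c ^+ 2 + 3) * y).

(** Lets the growth factor of [cgauss_step] also absorb the linear growth of the slope in the end
    terms of the telescoped sum. *)
Lemma step_bound_dominates c y : 1 <= c -> 1 <= y -> c * y <= step_bound c y.
Proof.
move=> c1 y1; have c0 : 0 <= c by lra.
have c2 : 0 <= c ^+ 2 by apply: sqr_ge0.
apply: ler_pM; rewrite ?(le_trans _ y1)//.
  have : c ^+ 1 <= c ^+ 5 by apply: ler_weXn2l.
  by rewrite expr1; lra.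
apply: le_trans (expR_ge1Dx _).
have : 0 <= c ^+ 2 * y by rewrite mulr_ge0//; lra.
by rewrite mulrDl -mulrA; lra.
Qed.

(* [t * (d - 2 A k z) * cgauss z] is the first-order term in [t]. *)
Lemma cgauss_step A k d z t c y :
  0 <= t <= 1 -> 1 <= c -> 1 <= y -> normc k <= c ->
  normc A <= c * y -> normc d <= c * y -> normc z <= c * y ->
  normc ((A + t%:C%C * d) * cgauss (z + t%:C%C * k) - A * cgauss z
         - t%:C%C * ((d - 2 * A * k * z) * cgauss z))
  <= t ^+ 2 * (normc (cgauss z) * step_bound c y).
Proof.
move=> /andP[t0 t1] c1 y1 kc Ac dc zc.
have c0 : 0 <= c by lra.
have y0 : 0 <= y by lra.
have cy0 : 0 <= c * y by apply: mulr_ge0.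
set T := t%:C%C; have nT : normc T = t by rewrite normcR ger0_norm.
set r := 3 * c ^+ 2 * y; set E := expR r.
(* Increment of the exponent: -(z + T k)^2 = -z^2 + v, so only [cexp v] has to be expanded. *)
set v := - (T * (2 * z * k + T * k ^+ 2)).
have vr : normc v <= t * r.
  rewrite normc_opp normcM nT ler_wpM2l//.
  apply: le_trans (normcD _ _) _; rewrite 2!normcM (normcM T) normcX nT.
  have -> : normc (2 : R[i]) = 2.
    have -> : (2 : R[i]) = 2%:C%C by rewrite rmorphD.
    by rewrite normcR ger0_norm.
  have h1 : 2 * normc z * normc k <= 2 * (c * y) * c.
    by rewrite ler_pM ?normc_ge0 ?mulr_ge0 ?normc_ge0// ler_wpM2l.
  have h2 : t * normc k ^+ 2 <= 1 * c ^+ 2.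
    by rewrite ler_pM ?exprn_ge0 ?normc_ge0// lerXn2r ?nnegrE ?normc_ge0.
  apply: le_trans (lerD h1 h2) _.
  have : c ^+ 2 * 1 <= c ^+ 2 * y by rewrite ler_wpM2l// sqr_ge0.
  by rewrite /r; lra.
have r0 : 0 <= r by rewrite !mulr_ge0// sqr_ge0.
have E1 : 1 <= E by rewrite -expR0 ler_expR.
set e := cexp v - 1 - v.
have eB : normc e <= 5 * (t ^+ 2 * r ^+ 2 * E).
  apply: le_trans (cexp_taylor v) _; rewrite ler_wpM2l//.
  rewrite ler_pM ?exprn_ge0 ?normc_ge0 ?expR_ge0//.
    by rewrite -exprMn lerXn2r ?nnegrE ?normc_ge0// mulr_ge0.
  by rewrite ler_expR (le_trans vr)// ler_piMl.
(* The part of A v linear in t is -2 T A k z, which cancels against the subtracted first-order term;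
   what remains has order t^2. *)
have -> : (A + T * d) * cgauss (z + T * k) - A * cgauss z
    - T * ((d - 2 * A * k * z) * cgauss z)
    = cgauss z * (- (T ^+ 2 * A * k ^+ 2) + T * d * v + (A + T * d) * e).
  have -> : cgauss (z + T * k) = cgauss z * (1 + v + e).
    rewrite /cgauss (_ : - (z + T * k) ^+ 2 = - z ^+ 2 + v); last first.
      by rewrite /v; ring.
    by rewrite cexpD /e; congr (_ * _); ring.
  by rewrite /v; ring.
rewrite normcM [leRHS]mulrCA ler_wpM2l ?normc_ge0//.
apply: le_trans (normcD _ _) _; apply: le_trans (lerD (normcD _ _) (lexx _)) _.
have h1 : normc (- (T ^+ 2 * A * k ^+ 2)) <= t ^+ 2 * (c * y) * c ^+ 2.
  rewrite normc_opp (normcM (_ * _)) (normcM (_ ^+ _)) !normcX nT.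
  rewrite ler_pM ?mulr_ge0 ?exprn_ge0 ?normc_ge0//.
    by rewrite ler_wpM2l ?exprn_ge0.
  by rewrite lerXn2r ?nnegrE ?normc_ge0.
have h2 : normc (T * d * v) <= t * (c * y) * (t * r).
  by rewrite !normcM nT ler_pM ?mulr_ge0 ?normc_ge0// ler_wpM2l.
have h3 : normc ((A + T * d) * e) <=
    (c * y + 1 * (c * y)) * (5 * (t ^+ 2 * r ^+ 2 * E)).
  rewrite normcM ler_pM ?normc_ge0//.
  apply: le_trans (normcD _ _) _; apply: lerD => //.
  by rewrite normcM nT ler_pM ?normc_ge0.
apply: le_trans (lerD (lerD h1 h2) h3) _.
(* Up to t^2 the three terms are at most 1, 3 and 90 = 2 * 5 * 3^2 times [Z], whence the 94 of
   [step_bound]; its exponent gains 3 y because y^3 <= e^(3 y). *)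
set Z := c ^+ 5 * (y ^+ 3 * E).
have cle m n : (m <= n)%N -> c ^+ m <= c ^+ n by apply: ler_weXn2l.
have yle m n : (m <= n)%N -> y ^+ m <= y ^+ n by apply: ler_weXn2l.
have k1 : c ^+ 3 * (y ^+ 1 * 1) <= Z.
  apply: ler_pM; rewrite ?cle ?mulr_ge0 ?exprn_ge0//.
  by apply: ler_pM; rewrite ?yle ?exprn_ge0.
have k2 : c ^+ 3 * (y ^+ 2 * 1) <= Z.
  apply: ler_pM; rewrite ?cle ?mulr_ge0 ?exprn_ge0//.
  by apply: ler_pM; rewrite ?yle ?exprn_ge0.
have k3 : Z <= c ^+ 5 * expR ((3 * c ^+ 2 + 3) * y).
  rewrite /Z ler_wpM2l ?exprn_ge0// mulrDl expRD mulrC /E /r.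
  rewrite ler_wpM2l ?expR_ge0//.
  rewrite expRM_natl lerXn2r ?nnegrE ?expR_ge0//.
  by apply: le_trans (expR_ge1Dx y); lra.
rewrite /step_bound -[94 * _ * _]mulrA.
have -> : t ^+ 2 * (c * y) * c ^+ 2 + t * (c * y) * (t * r) +
    (c * y + 1 * (c * y)) * (5 * (t ^+ 2 * r ^+ 2 * E)) =
    t ^+ 2 * (c ^+ 3 * (y ^+ 1 * 1) + 3 * (c ^+ 3 * (y ^+ 2 * 1)) + 90 * Z).
  by rewrite /Z /r; ring.
by rewrite ler_wpM2l ?sqr_ge0//; lra.
Qed.

End GaussianPath.

(** A mean value inequality without derivatives: over N equal steps the linear parts add up to [e]
    and the quadratic parts to [K / N], which vanishes as N grows. Hence [K] drops out of the
    conclusion. *)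
Lemma lipschitz_of_second_order (R : realType) (Phi : R -> R[i]) (e K : R) :
  (forall s t, 0 <= s -> 0 <= t -> s + t <= 1 ->
     normc (Phi (s + t) - Phi s) <= t * e + t ^+ 2 * K) ->
  normc (Phi 1 - Phi 0) <= e.
Proof.
move=> step; apply/ler_addgt0Pr => d d0.
pose n := Num.trunc (`|K| / d); pose N : R := n.+1%:R.
have N0 : 0 < N by rewrite ltr0n.
have KN : `|K| / N <= d.
  by rewrite ler_pdivrMr// mulrC -ler_pdivrMr// ltW// truncnS_gt.
have -> : Phi 1 - Phi 0 =
    \sum_(0 <= i < n.+1) (Phi (i.+1%:R / N) - Phi (i%:R / N)).
  by rewrite (telescope_sumr (fun i => Phi (i%:R / N)))// mul0r divff// gt_eqF.
apply: le_trans (normc_sum _ _ _) _.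
apply: (@le_trans _ _ (\sum_(0 <= i < n.+1) (N^-1 * e + N^-1 ^+ 2 * K))).
  apply: ler_sum_nat => i /andP[_ iN].
  rewrite -natr1 mulrDl mul1r; apply: step.
  - by rewrite divr_ge0// ltW.
  - by rewrite invr_ge0 ltW.
  - by rewrite -[X in _ + X]mul1r -mulrDl natr1 ler_pdivrMr// mul1r ler_nat.
rewrite sumr_const_nat subn0 -mulr_natl -/N mulrDr mulrA divff ?gt_eqF// mul1r.
rewrite lerD2l expr2 !mulrA divff ?gt_eqF// mul1r mulrC.
apply: le_trans KN; rewrite ler_wpM2r ?invr_ge0 ?(ltW N0)//.
exact: ler_norm.
Qed.

(** * Symmetric half-open grids and sums of exponentials over them *)

Section GaussianSum.
Variable R : realType.
Implicit Types (x s t dl : R) (M : nat).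

(** For j below M + M these are the multiples of [dl] in [-dl M, dl M), the shape of both
    lattices. *)
Definition gridpt dl M j : R := dl * (j%:R - M%:R).

Lemma gridptS dl M j : gridpt dl M j.+1 = gridpt dl M j + dl.
Proof. by rewrite /gridpt -natr1; ring. Qed.

(** Since dl <= e^dl - 1, each term is at most a difference of consecutive exponentials, and these
    telescope. *)
Lemma sum_exp_nat dl n : 0 < dl ->
  \sum_(0 <= j < n) dl * expR (- (dl * j.+1%:R)) <= 1.
Proof.
move=> dl0.
have : \sum_(0 <= j < n) dl * expR (- (dl * j.+1%:R)) <=
    \sum_(0 <= j < n) (expR (- (dl * j%:R)) - expR (- (dl * j.+1%:R))).
  apply: ler_sum => j _.
  have -> : - (dl * j%:R) = dl + - (dl * j.+1%:R) by rewrite -natr1; ring.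
  rewrite expRD -[X in _ - X]mul1r -mulrBl ler_wpM2r ?expR_ge0//.
  by have := expR_ge1Dx dl; lra.
move=> /le_trans; apply.
rewrite (telescope_sumr_eq (fun j => - expR (- (dl * j%:R))))//; last first.
  by move=> k _; rewrite opprK addrC.
rewrite mulr0 oppr0 expR0 opprK addrC gerDl oppr_le0.
exact: expR_ge0.
Qed.

(** Folds the grid at 0. Being half-open it contains 0 and its left end only, so the negative half
    is shifted by one index. *)
Lemma sum_grid (V : zmodType) (F : R -> V) dl M :
  \sum_(0 <= j < M + M) F (gridpt dl M j) =
  \sum_(0 <= j < M) (F (- (dl * j.+1%:R)) + F (dl * j%:R)).
Proof.
rewrite (@big_cat_nat _ _ _ M) ?leq_addr//= big_split/=; congr (_ + _).
  rewrite big_nat_rev /= [LHS]big_nat [RHS]big_nat; apply: eq_bigr => j.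
  rewrite add0n => /= jM; congr F; rewrite /gridpt natrB//; ring.
rewrite -{1}[M]add0n big_addn addnK; apply: eq_bigr => j _; congr F.
by rewrite /gridpt natrD; ring.
Qed.

(** The negative points contribute at most 1, the positive ones at most 1, and the point 0
    contributes dl <= 1. *)
Lemma sum_grid_exp dl M : 0 < dl <= 1 ->
  \sum_(0 <= j < M + M) dl * expR (- `|gridpt dl M j|) <= 3.
Proof.
move=> /andP[dl0 dl1]; rewrite (sum_grid (fun x => dl * expR (- `|x|))) big_split /=.
have h1 := sum_exp_nat M dl0.
have -> : \sum_(0 <= j < M) dl * expR (- `|- (dl * j.+1%:R)|) =
    \sum_(0 <= j < M) dl * expR (- (dl * j.+1%:R)).
  apply: eq_bigr => j _; rewrite normrN ger0_norm//.
  by rewrite mulr_ge0// ltW.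
suff : \sum_(0 <= j < M) dl * expR (- `|dl * j%:R|) <= 2 by lra.
case: M {h1} => [|M]; first by rewrite big_geq.
rewrite big_nat_recl// mulr0 normr0 oppr0 expR0 mulr1.
have h2 := sum_exp_nat M dl0.
suff -> : \sum_(0 <= j < M) dl * expR (- `|dl * j.+1%:R|) =
    \sum_(0 <= j < M) dl * expR (- (dl * j.+1%:R)) by lra.
by apply: eq_bigr => j _; rewrite ger0_norm// mulr_ge0// ltW.
Qed.

End GaussianSum.

(** * Deformation of a slanted line to the real line *)

Section GaussianContour.
Variables (R : realType) (w g : R[i]) (c kap : R).
Implicit Types (x s t dl : R).

(** At time s the moving line is x |-> [zt s x]: the real line at s = 0 and x |-> w x + g at s = 1.
    Its x-derivative is [W s] and its s-derivative is [slope x]. *)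
Local Notation W s := (1 + s%:C%C * (w - 1)).
Local Notation slope x := ((w - 1) * x%:C%C + g).
Local Notation zt s x := (W s * x%:C%C + s%:C%C * g).

Hypothesis c_ge1 : 1 <= c.
Hypothesis W_le : forall s, 0 <= s <= 1 -> normc (W s) <= c.
Hypothesis dw_le : normc (w - 1) <= c.
Hypothesis g_le : normc g <= c.
Hypothesis kap_gt0 : 0 < kap.
Hypothesis kap_le : forall s, 0 <= s <= 1 -> kap <= complex.Re (W s ^+ 2).

Let c_ge0 : 0 <= c. Proof. exact: le_trans ler01 c_ge1. Qed.

Lemma slope_le x : normc (slope x) <= c * (1 + `|x|).
Proof.
apply: le_trans (normcD _ _) _; rewrite normcM normcR addrC mulrDr mulr1.
by rewrite lerD// ler_wpM2r.
Qed.

Lemma normc_unit_scale s : 0 <= s <= 1 -> normc (s%:C%C * g) <= c.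
Proof.
move=> /andP[s0 s1]; rewrite normcM normcR ger0_norm// (le_trans _ g_le)//.
by rewrite ler_piMl// normc_ge0.
Qed.

Lemma zt_le s x : 0 <= s <= 1 -> normc (zt s x) <= c * (1 + `|x|).
Proof.
move=> s01; apply: le_trans (normcD _ _) _.
rewrite normcM normcR [leLHS]addrC [leRHS]mulrDr mulr1.
by rewrite lerD// ?normc_unit_scale// ler_wpM2r// W_le.
Qed.

(** The modulus only sees the real part of the exponent: its leading term is controlled by [kap],
    the cross term and the constant term by their moduli. *)
Lemma cgauss_decay s x : 0 <= s <= 1 ->
  normc (cgauss (zt s x)) <=
  expR (- (kap * x ^+ 2) + 2 * c ^+ 2 * `|x| + c ^+ 2).
Proof.
move=> s01; rewrite normc_cexp ler_expR.
set G := s%:C%C * g; set V := W s.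
have GB : normc G <= c by apply: normc_unit_scale.
have VB : normc V <= c by apply: W_le.
have -> : - (V * x%:C%C + G) ^+ 2 =
    - (V ^+ 2 * (x ^+ 2)%:C%C) - (2%:C%C * V * x%:C%C * G + G ^+ 2).
  by rewrite rmorphXn /= (_ : 2%:C%C = 2 :> R[i]) ?rmorphD//; ring.
have reD (a b : R[i]) : complex.Re (a - b) = complex.Re a - complex.Re b.
  by case: a b => [? ?] [].
rewrite reD; have -> : complex.Re (- (V ^+ 2 * (x ^+ 2)%:C%C)) =
    - (complex.Re (V ^+ 2) * x ^+ 2).
  by case: (V ^+ 2) => a b /=; rewrite mulr0 subr0.
rewrite -addrA lerD//.
  by rewrite lerN2 ler_wpM2r ?sqr_ge0 ?kap_le.
apply: le_trans (ler_norm _) _; rewrite normrN.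
apply: le_trans (normc_Re _) _; apply: le_trans (normcD _ _) _.
rewrite (normcM (_ * _)) (normcM (_ * V)) (normcM _ V) !normcR normcX.
rewrite [ `|2| ]ger0_norm//; apply: lerD.
  have : normc V * normc G <= c * c by rewrite ler_pM ?normc_ge0.
  rewrite -expr2 => h.
  have := ler_wpM2r (normr_ge0 x) h.
  by rewrite -!mulrA [`|x| * normc G]mulrC; lra.
by rewrite lerXn2r ?nnegrE ?normc_ge0.
Qed.

(* Obtained from [cgauss_decay] by completing the square in the exponent. *)
Definition contour_bound : R := 94 * c ^+ 5 *
  expR ((5 * c ^+ 2 + 4) ^+ 2 / (4 * kap) + (4 * c ^+ 2 + 3)).

Lemma contour_decay s x : 0 <= s <= 1 ->
  normc (cgauss (zt s x)) * step_bound c (1 + `|x|) <=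
  contour_bound * expR (- `|x|).
Proof.
(* Total coefficient of |x| to be beaten by kap x^2: 2 c^2 from [cgauss_decay], 3 c^2 + 3 from
   [step_bound], and 1 for the factor e^(-|x|) that is to remain. *)
set a := 5 * c ^+ 2 + 4; rewrite /contour_bound -/a.
move=> s01.
apply: le_trans (ler_wpM2r _ (cgauss_decay x s01)) _.
  by rewrite /step_bound !mulr_ge0 ?exprn_ge0 ?expR_ge0.
rewrite /step_bound mulrCA -[leRHS]mulrA.
apply: ler_wpM2l; first by rewrite mulr_ge0 ?exprn_ge0.
rewrite -!expRD ler_expR.
set u : R := `|x|; have -> : x ^+ 2 = u ^+ 2 by rewrite real_normK ?num_real.
have : 0 <= kap * (u - a / (2 * kap)) ^+ 2 by rewrite mulr_ge0 ?sqr_ge0 ?ltW.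
have -> : kap * (u - a / (2 * kap)) ^+ 2 =
    kap * u ^+ 2 - a * u + a ^+ 2 / (4 * kap).
  by field; rewrite gt_eqF.
have -> : a * u = 5 * (c ^+ 2 * u) + 4 * u by rewrite /a; ring.
set q := a ^+ 2 / _ => h.
have -> : (3 * c ^+ 2 + 3) * (1 + u) =
  3 * c ^+ 2 + 3 + 3 * (c ^+ 2 * u) + 3 * u by ring.
by lra.
Qed.

(* Both [s |-> W s * cgauss (zt s x)] and [x |-> slope x * cgauss (zt s x)]
   have the derivative [drift s x]: this is Cauchy's theorem for the strip
   swept by the moving line. *)
Let drift s x : R[i] :=
  ((w - 1) - 2 * W s * slope x * zt s x) * cgauss (zt s x).

(** In [cgauss_step] the direction is now [slope x], which grows with x, so c (1 + |x|) replaces c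
    and y is 1. The coarse remainder is harmless: it only enters the constant [K] of
    [lipschitz_of_second_order]. *)
Lemma drift_s s t x : 0 <= s -> 0 <= t -> s + t <= 1 ->
  normc (W (s + t) * cgauss (zt (s + t) x) - W s * cgauss (zt s x)
         - t%:C%C * drift s x)
  <= t ^+ 2 * (expR (- (kap * x ^+ 2) + 2 * c ^+ 2 * `|x| + c ^+ 2)
               * step_bound (c * (1 + `|x|)) 1).
Proof.
move=> s0 t0 st1; have s01 : 0 <= s <= 1 by lra.
have u1 : 1 <= 1 + `|x| by rewrite lerDl.
have cc : c <= c * (1 + `|x|) by rewrite ler_peMr.
have cu1 : 1 <= c * (1 + `|x|) by apply: le_trans c_ge1 cc.
have -> : W (s + t) = W s + t%:C%C * (w - 1) by rewrite rmorphD /=; ring.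
have -> : (W s + t%:C%C * (w - 1)) * x%:C%C + (s + t)%:C%C * g =
  zt s x + t%:C%C * slope x by rewrite rmorphD /=; ring.
apply: le_trans (@cgauss_step _ (W s) (slope x) (w - 1) (zt s x)
  t _ 1 _ _ _ _ _ _ _) _.
- by lra.
- exact: cu1.
- by [].
- exact: slope_le.
- by rewrite mulr1 (le_trans (W_le s01)).
- by rewrite mulr1 (le_trans dw_le).
- by rewrite mulr1 zt_le.
rewrite ler_wpM2l ?sqr_ge0// ler_wpM2r ?cgauss_decay//.
by rewrite /step_bound !mulr_ge0 ?exprn_ge0 ?expR_ge0// (le_trans _ cu1).
Qed.

(** The amplitude and the direction of [drift_s] exchange roles, and the first-order term is
    symmetric in them. The direction [W s] is bounded, so the growth in x goes into y, where
    [contour_decay] can absorb it. *)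
Lemma drift_x s x dl : 0 <= s <= 1 -> 0 <= dl <= 1 ->
  normc (slope (x + dl) * cgauss (zt s (x + dl)) - slope x * cgauss (zt s x)
         - dl%:C%C * drift s x)
  <= dl ^+ 2 * (normc (cgauss (zt s x)) * step_bound c (1 + `|x|)).
Proof.
move=> s01 dl01; have u1 : 1 <= 1 + `|x| by rewrite lerDl.
have cc : c <= c * (1 + `|x|) by rewrite ler_peMr.
have -> : (w - 1) * (x + dl)%:C%C + g = slope x + dl%:C%C * (w - 1).
  by rewrite rmorphD /=; ring.
have -> : W s * (x + dl)%:C%C + s%:C%C * g = zt s x + dl%:C%C * W s.
  by rewrite rmorphD /=; ring.
have -> : drift s x =
    ((w - 1) - 2 * slope x * W s * zt s x) * cgauss (zt s x).
  by rewrite /drift; ring.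
apply: cgauss_step => //.
- exact: W_le.
- exact: slope_le.
- exact: le_trans dw_le _.
- exact: zt_le.
Qed.

(** The exponential term comes from the two end values of the telescoped sum, the term 3 dl from the
    remainders of [drift_x] summed by [sum_grid_exp]. *)
Lemma contour_deformation dl (M : nat) : 0 < dl <= 1 ->
  normc (\sum_(0 <= j < M + M) dl%:C%C *
           (w * cgauss (w * (gridpt dl M j)%:C%C + g)) -
         \sum_(0 <= j < M + M) dl%:C%C * cgauss (gridpt dl M j)%:C%C)
  <= contour_bound * (3 * dl + 2 * expR (- (dl * M%:R))).
Proof.
move=> /andP[dl0 dl1]; set B := contour_bound.
have B0 : 0 <= B by rewrite !mulr_ge0 ?exprn_ge0 ?expR_ge0.
pose Phi s := \sum_(0 <= j < M + M)
  dl%:C%C * (W s * cgauss (zt s (gridpt dl M j))).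
have -> : \sum_(0 <= j < M + M) dl%:C%C *
    (w * cgauss (w * (gridpt dl M j)%:C%C + g)) = Phi 1.
  apply: eq_bigr => j _; rewrite !mul1r (addrC 1) subrK.
  by [].
have -> : \sum_(0 <= j < M + M) dl%:C%C * cgauss (gridpt dl M j)%:C%C = Phi 0.
  by apply: eq_bigr => j _; rewrite !mul0r !addr0 !mul1r.
pose K := \sum_(0 <= j < M + M) dl * (expR (- (kap * gridpt dl M j ^+ 2) +
  2 * c ^+ 2 * `|gridpt dl M j| + c ^+ 2) *
  step_bound (c * (1 + `|gridpt dl M j|)) 1).
apply: (@lipschitz_of_second_order _ _ _ K) => s t s0 t0 st1.
have s01 : 0 <= s <= 1 by lra.
have -> : Phi (s + t) - Phi s =
    t%:C%C * (\sum_(0 <= j < M + M) dl%:C%C * drift s (gridpt dl M j)) +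
    \sum_(0 <= j < M + M) dl%:C%C *
      (W (s + t) * cgauss (zt (s + t) (gridpt dl M j))
       - W s * cgauss (zt s (gridpt dl M j)) - t%:C%C * drift s (gridpt dl M j)).
  rewrite mulr_sumr /Phi -sumrB -big_split; apply: eq_bigr => j _ /=.
  by ring.
apply: le_trans (normcD _ _) _; apply: lerD; last first.
  apply: le_trans (normc_sum _ _ _) _; rewrite mulr_sumr; apply: ler_sum => j _.
  rewrite normcM normcR ger0_norm ?(ltW dl0)// [leRHS]mulrCA ler_wpM2l ?(ltW dl0)//.
  exact: drift_s.
rewrite normcM normcR ger0_norm// ler_wpM2l//.
set q := fun x => slope x * cgauss (zt s x).
have qB x : normc (q x) <= B * expR (- `|x|).
  apply: le_trans (contour_decay x s01); rewrite normcM mulrC ler_wpM2l ?normc_ge0//.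
  apply: le_trans (slope_le x) _; apply: step_bound_dominates => //.
  by rewrite lerDl.
(* Each drift term is an increment of [q] between neighbouring grid points minus a remainder of
   order dl^2. *)
have -> : \sum_(0 <= j < M + M) dl%:C%C * drift s (gridpt dl M j) =
    (q (dl * M%:R) - q (- (dl * M%:R))) -
    \sum_(0 <= j < M + M) (q (gridpt dl M j + dl) - q (gridpt dl M j)
      - dl%:C%C * drift s (gridpt dl M j)).
  have -> : q (dl * M%:R) - q (- (dl * M%:R)) =
      \sum_(0 <= j < M + M) (q (gridpt dl M j + dl) - q (gridpt dl M j)).
    rewrite (telescope_sumr_eq (fun j => q (gridpt dl M j)))//.
      by rewrite /gridpt natrD addrK sub0r mulrN.
    by move=> j _; rewrite gridptS.
  by rewrite -sumrB; apply: eq_bigr => j _; ring.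
apply: le_trans (normcB _ _) _; rewrite [3 * dl + _]addrC mulrDr.
apply: lerD.
  apply: le_trans (normcB _ _) _.
  apply: le_trans (lerD (qB _) (qB _)) _.
  by rewrite normrN ger0_norm ?mulr_ge0 ?(ltW dl0)//; lra.
apply: le_trans (normc_sum _ _ _) _.
apply: (@le_trans _ _ (\sum_(0 <= j < M + M)
    B * dl * (dl * expR (- `|gridpt dl M j|)))).
  apply: ler_sum => j _.
  apply: le_trans (drift_x (gridpt dl M j) s01 _) _; first by lra.
  apply: le_trans (ler_wpM2l (sqr_ge0 _) (contour_decay _ s01)) _.
  by rewrite -/B le_eqVlt; apply/orP; left; apply/eqP; ring.
rewrite -mulr_sumr mulrA (mulrAC B) -mulrA mulrA mulrAC -mulrA.
have := @sum_grid_exp _ dl M; rewrite dl0 dl1 => /(_ isT) h.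
have Bd : 0 <= B * dl by rewrite mulr_ge0// ltW.
have := ler_wpM2l Bd h.
by rewrite -!mulrA; lra.
Qed.

End GaussianContour.

(** * Riemann sums of the real Gaussian *)

Section GaussianRiemannSum.
Variable R : realType.
Implicit Types (x dl : R) (M : nat).

Local Notation I0 := (@gauss_integral_proof.integral0_gauss R).
Local Notation mu := (@lebesgue_measure R).

Lemma integrable_gauss (A : set (measurableTypeR R)) :
  measurable A -> mu.-integrable A (EFin \o (@gauss_fun R)).
Proof.
move=> mA; apply: (integrableS measurableT) => //.
exact: integrableT_gauss.
Qed.

Lemma ler_gauss x y : 0 <= x -> x <= y -> gauss_fun y <= gauss_fun x.
Proof.
move=> x0 xy; rewrite ler_expR lerN2 lerXn2r ?nnegrE//.
exact: le_trans x0 xy.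
Qed.

(** The Gaussian decreases on the nonnegative half-line, so the integral over a cell lies between
    the rectangles of its right and left ends. *)
Lemma integral0_gauss_step x dl : 0 <= x -> 0 < dl ->
  dl * gauss_fun (x + dl) <= I0 (x + dl) - I0 x <= dl * gauss_fun x.
Proof.
move=> x0 dl0.
have xl : x < x + dl by rewrite ltrDl.
have mI : measurable (`]x, x + dl] : set (measurableTypeR R)) by [].
have muI : mu `]x, x + dl]%classic = dl%:E.
  by rewrite lebesgue_measure_itv /= lte_fin xl -EFinB addrAC subrr add0r.
rewrite /gauss_integral_proof.integral0_gauss Rintegral_itvB; last 3 first.
- exact: integrable_gauss.
- by rewrite bnd_simp.
- by rewrite bnd_simp ltW.
have icst (r : R) : mu.-integrable `]x, x + dl]%classic (EFin \o cst r).
  apply: (@integrableS _ _ _ mu `[x, x + dl]%classic) => //.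
    exact: subset_itv_oc_cc.
  apply: continuous_compact_integrable; first exact: segment_compact.
  by apply: continuous_subspaceT => z; exact: cvg_cst.
have cstE (r : R) : \int[mu]_(_ in `]x, (x + dl)]) r = dl * r.
  by rewrite Rintegral_cst// [X in fine X]muI /= mulrC.
apply/andP; split; rewrite -cstE; apply: le_Rintegral => //.
- exact: icst.
- exact: integrable_gauss.
- move=> t /=; rewrite in_itv /= => /andP[xt tx]; apply: ler_gauss => //.
  exact: le_trans x0 (ltW xt).
- exact: integrable_gauss.
- exact: icst.
- by move=> t /=; rewrite in_itv /= => /andP[xt tx]; apply: ler_gauss => //; exact: ltW.
Qed.

Lemma integral0_gauss0 : I0 0 = 0.
Proof. by rewrite /gauss_integral_proof.integral0_gauss set_itv1 Rintegral_set1. Qed.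

Lemma gauss_sum_bounds dl M : 0 < dl ->
  \sum_(0 <= j < M) dl * gauss_fun (dl * j.+1%:R) <= I0 (dl * M%:R)
  <= \sum_(0 <= j < M) dl * gauss_fun (dl * j%:R).
Proof.
move=> dl0; elim: M => [|M /andP[lo hi]].
  by rewrite !big_geq// mulr0 integral0_gauss0 lexx.
rewrite !big_nat_recr//=.
have := @integral0_gauss_step (dl * M%:R) dl.
rewrite -[X in _ + X]mulr1 -mulrDr natr1 mulr_ge0 ?(ltW dl0)//.
by move=> /(_ isT dl0); lra.
Qed.

(** Folded at 0, the sum is a lower sum [U] plus an upper sum [V] of the same integral, and V - U
    telescopes to at most dl times the value 1 at the origin. *)
Lemma gauss_riemann_sum dl M : 0 < dl ->
  `|\sum_(0 <= j < M + M) dl * gauss_fun (gridpt dl M j) - 2 * I0 (dl * M%:R)|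
  <= dl.
Proof.
move=> dl0; rewrite (sum_grid (fun x => dl * gauss_fun x)) big_split /=.
have gaussN x : gauss_fun (- x) = gauss_fun x by rewrite /gauss_fun sqrrN.
under eq_bigr do rewrite gaussN.
have := @gauss_sum_bounds dl M dl0.
set U := \sum_(0 <= j < M) dl * gauss_fun (dl * j.+1%:R).
set V := \sum_(0 <= j < M) dl * gauss_fun (dl * j%:R).
have : V - U <= dl.
  rewrite -sumrB (telescope_sumr_eq (fun j => - (dl * gauss_fun (dl * j%:R))))//.
    rewrite mulr0 opprK addrC {1}/gauss_fun expr0n oppr0 expR0 mulr1 gerDl.
    by rewrite oppr_le0 mulr_ge0 ?gauss_fun_ge0// ltW.
  by move=> j _; rewrite opprK addrC.
by move=> h1 h2; rewrite ler_norml; lra.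
Qed.

Lemma gauss_sum_limit (e : R) : 0 < e -> exists T dl0 : R, 0 < dl0 /\
  forall dl M, 0 < dl <= dl0 -> T < dl * M%:R ->
  `|\sum_(0 <= j < M + M) dl * gauss_fun (gridpt dl M j) - Num.sqrt pi| < e.
Proof.
move=> e0; pose q : R := Num.sqrt pi / 2.
have q0 : 0 < q by rewrite divr_gt0// sqrtr_gt0 pi_gt0.
have qq : q ^+ 2 = pi / 4.
  by rewrite /q expr_div_n sqr_sqrtr ?pi_ge0//; congr (_ / _); ring.
(* The known limit is I^2 -> pi / 4 = q^2. As |q^2 - I^2| = |q - I| (q + I) >= |q - I| q, this
   threshold yields |q - I| < e / 4. *)
have eq0 : 0 < e / 4 * q by rewrite mulr_gt0// divr_gt0.
have /cvgrPdist_lt/(_ _ eq0)[T [_ HT]] :=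
  @gauss_integral_proof.cvg_integral0_gauss_sqr R.
exists T, (e / 2); split; first by rewrite divr_gt0.
move=> dl M /andP[dl0 dle] TM.
have := HT _ TM; rewrite /= -qq.
set I := I0 _; have I_ge0 : 0 <= I by apply: gauss_integral_proof.integral0_gauss_ge0.
rewrite subr_sqr normrM => h.
have h2 : `|q - I| < e / 4.
  rewrite -(ltr_pM2r q0); apply: le_lt_trans h.
  by rewrite ler_wpM2l// ger0_norm ?lerDl ?addr_ge0// ltW.
have := gauss_riemann_sum M dl0; rewrite -/I.
have sq : Num.sqrt pi = 2 * q by rewrite /q mulrC divfK.
move: h2; rewrite sq ltr_norml ler_norml ltr_norml.
by lra.
Qed.

End GaussianRiemannSum.

(** * Limit of the complex Gaussian sums, uniformly in the shift *)

Section ComplexGaussianSum.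
Variable R : realType.

(** Re (z^2) = (Re z - Im z)(Re z + Im z), and along the segment from 1 to w each factor
    interpolates affinely between 1 and a positive number. *)
Lemma cone_path (w : R[i]) : `|complex.Im w| < complex.Re w ->
  exists2 kap : R, 0 < kap & forall s : R, 0 <= s <= 1 ->
    kap <= complex.Re ((1 + s%:C%C * (w - 1)) ^+ 2).
Proof.
case: w => p q pq; have /andP[h1 h2] : - p < q < p by rewrite -ltr_norml.
pose m := Num.min 1 (Num.min (p - q) (p + q)).
have m0 : 0 < m by rewrite !lt_min; lra.
have m1 : m <= 1 by rewrite ge_min lexx.
have m2 : m <= p - q by rewrite !ge_min lexx orbT.
have m3 : m <= p + q by rewrite !ge_min lexx !orbT.
exists (m ^+ 2) => [|s /andP[s0 s1]]; first exact: exprn_gt0.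
have -> : complex.Re ((1 + s%:C%C * ((p +i* q)%C - 1)) ^+ 2) =
   ((1 - s) + s * (p - q)) * ((1 - s) + s * (p + q)).
  by rewrite expr2 /=; ring.
have lo u : m <= u -> m <= (1 - s) + s * u.
  move=> mu; have : s * m <= s * u by rewrite ler_wpM2l.
  have : (1 - s) * m <= (1 - s) * 1 by rewrite ler_wpM2l// subr_ge0.
  by lra.
by rewrite expr2 ler_pM ?(ltW m0)// lo.
Qed.

Lemma cgauss_real (x : R) : cgauss x%:C%C = (gauss_fun x)%:C%C.
Proof.
rewrite /cgauss /gauss_fun -rmorphXn -rmorphN /cexp /= cos0 sin0.
by rewrite -[(1 +i* 0)%C]/(1 : R[i]) mulr1.
Qed.

Lemma complex_gauss_sum_limit (w : R[i]) (G e : R) :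
  `|complex.Im w| < complex.Re w -> 0 < e ->
  exists T dl0 : R, 0 < dl0 /\
  forall (dl : R) (M : nat) (g : R[i]), 0 < dl <= dl0 -> T < dl * M%:R ->
    normc g <= G ->
  normc (\sum_(0 <= j < M + M) dl%:C%C *
    (w * cgauss (w * (gridpt dl M j)%:C%C + g)) - (Num.sqrt pi)%:C%C) < e.
Proof.
move=> /cone_path[kap kap0 kapP] e0.
(* A common bound for 1, w - 1, all [1 + s (w - 1)] and all admissible g; since g enters the
   deformation bound only through [c], the limit is uniform in g. *)
pose c := 2 + normc w + `|G|; pose B := contour_bound c kap.
have w0 := normc_ge0 w; have G0 := normr_ge0 G.
have c1 : 1 <= c by rewrite /c; lra.
have dwc : normc (w - 1) <= c.
  by apply: le_trans (normcB _ _) _; rewrite normc1 /c; lra.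
have Wc (s : R) : 0 <= s <= 1 -> normc (1 + s%:C%C * (w - 1)) <= c.
  move=> /andP[s0 s1].
  have -> : 1 + s%:C%C * (w - 1) = s%:C%C * w + (1 - s)%:C%C.
    by rewrite rmorphB rmorph1; ring.
  apply: le_trans (normcD _ _) _; rewrite normcM !normcR !ger0_norm ?subr_ge0//.
  have : s * normc w <= normc w by rewrite ler_piMl.
  by rewrite /c; lra.
have B0 : 0 <= B.
  by rewrite /B /contour_bound !mulr_ge0 ?exprn_ge0 ?expR_ge0// (le_trans _ c1).
have e2 : 0 < e / 2 by rewrite divr_gt0.
have [T1 [d1 [d10 H1]]] := gauss_sum_limit e2.
(* With [d2] the mesh error 3 B dl is at most e / 4, and with the threshold 8 B / e below so is the
   end error 2 B e^(-dl M); the real sum gets the other e / 2. *)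
pose d2 := e / (12 * (B + 1)).
have d20 : 0 < d2 by rewrite divr_gt0// mulr_gt0//; lra.
exists (Num.max T1 (8 * B / e)), (Num.min d1 (Num.min d2 1)).
split; first by rewrite !lt_min d10 d20 ltr01.
move=> dl M g /andP[dl0]; rewrite !le_min => /and3P[ld1 ld2 dl1].
rewrite gt_max => /andP[TM1 TM2] gG.
have gc : normc g <= c.
  by apply: le_trans gG _; have := ler_norm G; rewrite /c; lra.
have := @contour_deformation R w g c kap c1 Wc dwc gc kap0 kapP dl M.
rewrite dl0 dl1 => /(_ isT).
set S := (X in normc (X - _) <= _); set S0 := (X in normc (_ - X) <= _).
rewrite -/B => SS0.
have := H1 dl M; rewrite dl0 ld1 => /(_ isT TM1).
set S1 := (X in `|X - _|) => HS1.
have S01 : S0 = S1%:C%C.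
  rewrite /S0 /S1 rmorph_sum; apply: eq_bigr => j _ /=.
  by rewrite cgauss_real rmorphM.
have -> : S - (Num.sqrt pi)%:C%C = (S - S0) + (S1 - Num.sqrt pi)%:C%C.
  by rewrite rmorphB /= -S01; ring.
apply: le_lt_trans (normcD _ _) _; rewrite normcR.
have k1 : B * (12 * dl) <= e.
  have : dl * (12 * (B + 1)) <= e by rewrite -ler_pdivlMr ?mulr_gt0//; lra.
  by lra.
have k2 : 8 * B * expR (- (dl * M%:R)) <= e.
  set y := dl * M%:R; have y0 : 0 <= y by rewrite mulr_ge0 ?(ltW dl0).
  rewrite expRN -/(_ / _) ler_pdivrMr ?expR_gt0//.
  have : 8 * B <= e * y by rewrite [leRHS]mulrC -ler_pdivrMr// ltW.
  have : e * (1 + y) <= e * expR y by rewrite ler_wpM2l ?expR_ge1Dx// ltW.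
  by lra.
by lra.
Qed.

(** The principal root p + i q has p >= 0, and p^2 - q^2 = Re xi is positive. *)
Lemma sqrtc_cone (xi : R[i]) : 0 < complex.Re xi ->
  `|complex.Im (sqrtc xi)| < complex.Re (sqrtc xi).
Proof.
move=> xi0; have : 0 < complex.Re (sqrtc xi ^+ 2) by rewrite sqr_sqrtc.
have : 0 <= complex.Re (sqrtc xi) by case: (xi) => a b; apply: sqrtr_ge0.
case: (sqrtc xi) => p q /= p0; rewrite subr_gt0 -!expr2 => qp.
by rewrite -(ger0_norm p0) -!sqrtr_sqr ltr_sqrt// (le_lt_trans _ qp)// sqr_ge0.
Qed.

(* The factor of the product formula for [Cxi] attached to one lattice point. *)
Definition fibre_sum (xi : R[i]) (h h' : R) (M : nat) (beta : R) : R[i] :=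
  \sum_(0 <= j < M + M) ((Num.sqrt h)^-1 * h'^-1)%:C%C *
    cexp (- (pi%:C%C * (h^-1)%:C%C * xi *
      ((gridpt h'^-1 M j)%:C%C + ('i%C * xi^-1) * beta%:C%C) ^+ 2)).

Lemma fibre_sum_limit (xi : R[i]) (h b0 e : R) :
  0 < complex.Re xi -> 0 < h -> 0 < e ->
  exists T : R, forall (h' : R) (M : nat) (beta : R),
    T < h' -> M%:R * 2 = h * h' ^+ 2 -> `|beta| <= b0 ->
    normc (fibre_sum xi h h' M beta - 1 / sqrtc xi) < e.
Proof.
move=> xi0 h0 e0.
have xin0 : xi != 0 by apply/eqP => xi00; move: xi0; rewrite xi00 ltxx.
(* Chosen so that w^2 = pi xi / h: the exponent becomes minus the square of w x + g, with g
   proportional to [beta]. *)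
pose r := Num.sqrt (pi / h : R); pose sx := sqrtc xi; pose w := sx * r%:C%C.
have r0 : 0 < r by rewrite sqrtr_gt0 divr_gt0 ?pi_gt0.
have sx0 : sx != 0 by rewrite sqrtc_eq0.
have rC0 : r%:C%C != 0 :> R[i].
  by rewrite -(rmorph0 (real_complex R)) (inj_eq (@complexI R)) gt_eqF.
have w0 : w != 0 by rewrite mulf_neq0.
have wcone : `|complex.Im w| < complex.Re w.
  have := sqrtc_cone xi0; rewrite /w -/sx; case: (sx) => p q /= qp.
  by rewrite !mulr0 subr0 add0r normrM (gtr0_norm r0) ltr_pM2r.
have w2 : w ^+ 2 = pi%:C%C * (h^-1)%:C%C * xi.
  rewrite exprMn sqr_sqrtc -rmorphXn sqr_sqrtr ?divr_ge0 ?pi_ge0 ?(ltW h0)//.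
  by rewrite rmorphM mulrC.
set K := ((Num.sqrt h)^-1)%:C%C / w.
have K0 : 0 < normc K.
  rewrite lt_neqAle normc_ge0 andbT eq_sym; apply/eqP => /eq0_normc/eqP.
  rewrite mulf_eq0 invr_eq0 (negPf w0) orbF.
  rewrite -(rmorph0 (real_complex R)) (inj_eq (@complexI R)) invr_eq0 gt_eqF//.
  by rewrite sqrtr_gt0.
have KE : K * (Num.sqrt pi)%:C%C = 1 / sx.
  apply: (mulIf w0); rewrite mulrAC divfK// /w mulrA divfK// mul1r -rmorphM.
  congr (_%:C%C); rewrite /r sqrtrM ?pi_ge0// sqrtrV ?(ltW h0)//.
  by rewrite mulrC.
have eK : 0 < e / normc K by rewrite divr_gt0.
have [T [dl0 [dl00 HT]]] := complex_gauss_sum_limit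
  (normc (w * ('i%C * xi^-1)) * `|b0|) wcone eK.
(* The three thresholds make h' positive, the mesh 1 / h' at most [dl0], and the half-length M / h'
   = h h' / 2 larger than [T]. *)
exists (Num.max 1 (Num.max dl0^-1 (Num.max 0 T * 2 / h))) => h' M beta.
rewrite !gt_max => /and3P[h'1 h'dl h'T] M2 betab.
have h'0 : 0 < h' by lra.
have -> : fibre_sum xi h h' M beta = K *
    \sum_(0 <= j < M + M) (h'^-1)%:C%C * (w * cgauss
      (w * (gridpt h'^-1 M j)%:C%C + w * ('i%C * xi^-1) * beta%:C%C)).
  rewrite /fibre_sum mulr_sumr; apply: eq_bigr => j _.
  set a := 'i%C * xi^-1; set x := (gridpt _ _ _)%:C%C.
  have -> : w * x + w * a * beta%:C%C = w * (x + a * beta%:C%C) by ring.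
  rewrite /cgauss exprMn w2 rmorphM /= /K.
  set E := cexp _; set u := (_^-1)%:C%C; set v := (h'^-1)%:C%C.
  by rewrite (mulrCA v) [RHS]mulrA divfK// [RHS]mulrA.
rewrite -/sx -KE -mulrBr normcM -ltr_pdivlMl// [ltRHS]mulrC.
apply: HT.
- by rewrite invr_gt0 h'0 /= -[dl0]invrK lef_pV2 ?posrE ?invr_gt0// ltW.
- have -> : h'^-1 * M%:R = h' * (h / 2).
    have -> : M%:R = h * h' ^+ 2 / 2 :> R by rewrite -M2 mulfK.
    by field; rewrite gt_eqF.
  apply: (@le_lt_trans _ _ (Num.max 0 T)); first by rewrite le_max lexx orbT.
  by move: h'T; rewrite ltr_pdivrMr//; lra.
- rewrite normcM ler_wpM2l ?normc_ge0// normcR (le_trans betab)//.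
  exact: ler_norm.
Qed.

End ComplexGaussianSum.

(** * Sums over functions between finite grids *)

Section Grids.
Variable R : realType.
Implicit Types (x t dl : R) (M : nat).

Definition grid dl M : set R := [set gridpt dl M j | j in `I_(M + M)].

Lemma finite_grid dl M : finite_set (grid dl M).
Proof. exact/finite_image/finite_II. Qed.

Lemma gridpt_inj dl M : dl != 0 -> injective (gridpt dl M).
Proof.
by move=> dl0 i j /(mulfI dl0)/addIr/eqP; rewrite eqr_nat => /eqP.
Qed.

Lemma gridP dl M x : 0 < dl -> grid dl M x <->
  exists z : int, x = dl * z%:~R /\ - (dl * M%:R) <= x < dl * M%:R.
Proof.
move=> dl0; split=> [[j /= jM <-]|[z [-> /andP[]]]].
  exists (j%:Z - M%:Z); rewrite /gridpt intrD mulrNz; split=> //.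
  rewrite -mulrN ler_pM2l// ltr_pM2l// lerBrDr addNr ler0n ltrBlDr.
  by rewrite -natrD ltr_nat.
rewrite -mulrN ler_pM2l// ltr_pM2l// -[M%:R]/(M%:Z%:~R) -mulrNz.
rewrite ler_int ltr_int => Mz zM.
have zM0 : 0 <= z + M%:Z by rewrite -lerBlDr sub0r.
exists (absz (z + M%:Z)).
  rewrite /mkset -ltz_nat gez0_abs// PoszD.
  by rewrite ltrD2r.
rewrite /gridpt; congr (_ * _).
by rewrite -[_%:R]/((absz (z + M%:Z))%:Z%:~R) gez0_abs// intrD addrK.
Qed.

Lemma sum_over_grid (V : zmodType) dl M (F : R -> V) : dl != 0 ->
  \sum_(t \in grid dl M) F t = \sum_(0 <= j < M + M) F (gridpt dl M j).
Proof.
move=> dl0; rewrite fsbig_image; last by move=> i j _ _; exact: gridpt_inj.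
by rewrite -(fsbig_ord _ _ (fun j => F (gridpt dl M j))) big_mkord.
Qed.

Section GridFunctions.
Variables (dl dl' : R) (M M' : nat).

(** The value 0 off the grid matches the encoding of the elements of [Xset], whose fibres are the
    sets [gridfuns]. *)
Definition gridfun (f : {ffun 'I_(M + M) -> 'I_(M' + M')}) : R -> R := fun x =>
  if [pick j : 'I_(M + M) | gridpt dl M j == x] is Some j
  then gridpt dl' M' (f j) else 0.

Definition gridfuns : set (R -> R) := range gridfun.

Lemma finite_gridfuns : finite_set gridfuns.
Proof. exact/finite_image/finite_finset. Qed.

Hypotheses (dl0 : dl != 0) (dl'0 : dl' != 0).

Lemma gridfunE f (j : 'I_(M + M)) :
  gridfun f (gridpt dl M j) = gridpt dl' M' (f j).
Proof.
rewrite /gridfun; case: pickP => [i /eqP/(gridpt_inj dl0)/val_inj->//|].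
by move=> /(_ j); rewrite eqxx.
Qed.

Lemma gridfun_inj : injective gridfun.
Proof.
move=> f g fg; apply/ffunP => j; apply/val_inj/(@gridpt_inj _ M' dl'0).
by rewrite -!gridfunE fg.
Qed.

Lemma gridfunsP (a : R -> R) : gridfuns a <->
  (forall t, grid dl M t -> grid dl' M' (a t)) /\
  (forall t, ~ grid dl M t -> a t = 0).
Proof.
split=> [[f _ <-]|[aL a0]].
  split=> [_ [j /= jM <-]|t nt].
    by rewrite (gridfunE f (Ordinal jM)); exists (f (Ordinal jM)) => /=.
  rewrite /gridfun; case: pickP => // j /eqP jt; exfalso; apply: nt.
  by exists j => /=.
have /choice[f fP] (j : 'I_(M + M)) :
    exists i : 'I_(M' + M'), gridpt dl' M' i = a (gridpt dl M j).
  have [|i /= iM' ia] := aL (gridpt dl M j); first by exists j => /=.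
  by exists (Ordinal iM').
exists [ffun j => f j] => //; apply/funext => t; rewrite /gridfun.
case: pickP => [j /eqP <-|nt]; first by rewrite ffunE fP.
apply/esym/a0 => -[j /= jM jt].
by move: (nt (Ordinal jM)); rewrite /= jt eqxx.
Qed.

(** Distributivity: [gridfun] is injective, so the sum runs over all choices of one index i for each
    j, which is the expansion of the product of sums. *)
Lemma sum_gridfuns (V : comNzRingType) (phi : R -> R -> V) :
  \sum_(a \in gridfuns)
    \prod_(0 <= j < M + M) phi (gridpt dl M j) (a (gridpt dl M j)) =
  \prod_(0 <= j < M + M)
    \sum_(0 <= i < M' + M') phi (gridpt dl M j) (gridpt dl' M' i).
Proof.
rewrite fsbig_image; last by move=> f g _ _; exact: gridfun_inj.
transitivity (\sum_(f : {ffun 'I_(M + M) -> 'I_(M' + M')}) \prod_(j < M + M)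
    phi (gridpt dl M j) (gridpt dl' M' (f j))).
  rewrite [RHS]fsbig_seq ?index_enum_uniq//=.
  rewrite (_ : [set` _] = setT); last first.
    by apply/seteqP; split=> // f _; exact: mem_index_enum.
  apply: eq_fsbigr => f _; rewrite big_mkord; apply: eq_bigr => j _.
  by rewrite gridfunE.
rewrite -(bigA_distr_bigA (fun (j : 'I_(M + M)) (i : 'I_(M' + M')) =>
  phi (gridpt dl M j) (gridpt dl' M' i))) big_mkord.
apply: eq_bigr => j _.
by rewrite big_mkord.
Qed.

End GridFunctions.
End Grids.

(** * Product formula and limit in one fibre *)

Section Fibre.
Variable R : realType.

(** Continuity of an n-fold product at (c, ..., c), by induction on n through P s - c^n c = (P -
    c^n) s + c^n (s - c), each summand being allotted d / 2. *)
Lemma prod_near (c : R[i]) (n : nat) (d : R) : 0 < d ->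
  exists2 e : R, 0 < e & forall s : nat -> R[i],
    (forall j, (j < n)%N -> normc (s j - c) < e) ->
    normc (\prod_(0 <= j < n) s j - c ^+ n) < d.
Proof.
move=> d0; elim: n d d0 => [|n IHn] d d0.
  by exists 1 => // s _; rewrite big_geq// expr0 subrr normc0.
pose A := normc c + 1; have A0 : 0 < A by have := normc_ge0 c; rewrite /A; lra.
pose N := normc (c ^+ n) + 1.
have N0 : 0 < N by have := normc_ge0 (c ^+ n); rewrite /N; lra.
have [|e e0 He] := IHn (d / (2 * A)); first by rewrite divr_gt0// mulr_gt0.
exists (Num.min e (Num.min 1 (d / (2 * N)))).
  by rewrite !lt_min e0 ltr01 divr_gt0// mulr_gt0.
move=> s sP.
have {}He : normc (\prod_(0 <= j < n) s j - c ^+ n) < d / (2 * A).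
  apply: He => j jn; apply: lt_le_trans (sP j (ltnW jn)) _.
  by rewrite ge_min lexx.
have := sP n (ltnSn n); rewrite !lt_min => /and3P[_ s1 sN].
rewrite big_nat_recr//= exprSr; set P := \prod_(_ <= _ < _) _ in He *.
have -> : P * s n - c ^+ n * c = (P - c ^+ n) * s n + c ^+ n * (s n - c).
  by ring.
apply: le_lt_trans (normcD _ _) _; rewrite !normcM.
have sA : normc (s n) <= A.
  have -> : s n = c + (s n - c) by rewrite addrC subrK.
  by apply: le_trans (normcD _ _) _; rewrite /A lerD2l ltW.
have h1 : normc (P - c ^+ n) * normc (s n) <= d / (2 * A) * A.
  by rewrite ler_pM ?normc_ge0// ltW.
have h2 : normc (c ^+ n) * normc (s n - c) < d / 2.
  apply: (@le_lt_trans _ _ (N * normc (s n - c))).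
    by rewrite ler_wpM2r ?normc_ge0// /N lerDl.
  rewrite mulrC -ltr_pdivlMr//; apply: lt_le_trans sN _.
  by rewrite le_eqVlt; apply/orP; left; apply/eqP; field; rewrite gt_eqF.
have -> : d = d / 2 + d / 2 by field.
apply: le_lt_trans (lerD h1 (lexx _)) _.
have -> : d / (2 * A) * A = d / 2 by field; rewrite gt_eqF.
by rewrite ltrD2l.
Qed.

Definition fibre_C (xi : R[i]) (h h' : R) (M M' : nat) (b : R -> R) : R[i] :=
  \sum_(a \in gridfuns h^-1 h'^-1 M M')
    (h `^ (- (h ^+ 2) / 2) * h' `^ (- h ^+ 2))%:C%C *
    cexp (- (pi%:C%C * (h^-1)%:C%C * xi *
      (\sum_(k \in grid h^-1 M)
         ((a k)%:C%C + 'i%C * xi^-1 * (b k)%:C%C) ^+ 2))).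

(** The exponential turns the inner sum into a product. As the grid has M + M = h^2 points, the
    weight is the (M + M)-th power of h^(-1/2) / h', one factor for each point. *)
Lemma fibre_C_prod (xi : R[i]) (h h' : R) (M M' : nat) (b : R -> R) :
  0 < h -> 0 < h' -> M%:R * 2 = h ^+ 2 ->
  fibre_C xi h h' M M' b =
  \prod_(0 <= j < M + M) fibre_sum xi h h' M' (b (gridpt h^-1 M j)).
Proof.
move=> h0 h'0 M2.
have hn0 : h^-1 != 0 by rewrite invr_eq0 gt_eqF.
have h'n0 : h'^-1 != 0 by rewrite invr_eq0 gt_eqF.
rewrite /fibre_sum -(sum_gridfuns M M' hn0 h'n0 (fun x y =>
  ((Num.sqrt h)^-1 * h'^-1)%:C%C * cexp (- (pi%:C%C * (h^-1)%:C%C * xi *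
      (y%:C%C + 'i%C * xi^-1 * (b x)%:C%C) ^+ 2)))).
apply: eq_fsbigr => a _; rewrite big_split /= sum_over_grid//.
rewrite mulr_sumr -sumrN cexp_sum; congr (_ * _).
rewrite big_const_nat subn0 iter_mulr_1 -rmorphXn; congr (_%:C%C).
rewrite exprMn; congr (_ * _).
  have -> : - h ^+ 2 / 2 = - 2^-1 * (M + M)%:R.
    by rewrite -M2 natrD; field.
  rewrite powRrM powR_mulrn ?powR_ge0//; congr (_ ^+ _).
  by rewrite powRN powR12_sqrt// ltW.
have -> : - h ^+ 2 = -1 * (M + M)%:R by rewrite -M2 natrD; ring.
by rewrite powRrM powR_mulrn ?powR_ge0// powR_inv1// ltW.
Qed.

Lemma fibre_C_limit (xi : R[i]) (h b0 d : R) (M : nat) :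
  0 < complex.Re xi -> 0 < h -> M%:R * 2 = h ^+ 2 -> 0 < d ->
  exists T : R, forall (h' : R) (M' : nat) (b : R -> R),
    0 < h' -> T < h' -> M'%:R * 2 = h * h' ^+ 2 ->
    (forall k, grid h^-1 M k -> `|b k| <= b0) ->
    normc (fibre_C xi h h' M M' b - (1 / sqrtc xi) ^+ (M + M)) < d.
Proof.
move=> xi0 h0 M2 d0.
have [e e0 He] := prod_near (1 / sqrtc xi) (M + M) d0.
have [T HT] := fibre_sum_limit b0 xi0 h0 e0.
exists T => h' M' b h'0 Th' M'2 bb0; rewrite fibre_C_prod//.
by apply: He => j jM; apply: HT => //; apply: bb0; exists j.
Qed.

End Fibre.

(** * Internal sets and standard parts *)

Section InternalSets.
Variables (I : Type) (F : ultrafilter I).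

(* A bad point chosen in every fibre that has one is a single bad internal
   point, so the quantifier moves inside the filter. *)
Lemma uf_forall (T : Type) (P : I -> T -> Prop) :
  (forall x : I -> T, uf_sets F [set i | P i (x i)]) ->
  uf_sets F [set i | forall t, P i t].
Proof.
move=> HP; apply: contrapT => /uf_not nP.
have /choice[x xP] i : exists t : T, (exists t, ~ P i t) -> ~ P i t.
  have [[t nt]|np] := pselect (exists t, ~ P i t); first by exists t.
  have [t _] : exists t : T, True.
    have [i1 /= /existsNP[t _]] := filter_ex nP.
    by exists t.
  by exists t.
have [i /= [/existsNP ni Pi]] := uf_meet nP (HP x).
exact: xP ni Pi.
Qed.

Lemma uext_setC (T : Type) (S : I -> set T) (x : ultrapower F T) :
  ~ uext (ucl F S) x <-> uext (ucl F (fun i => ~` S i)) x.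
Proof.
elim/uclW: x => x; split=> [nx|/uext_ucl nx /uext_ucl Sx].
  by apply/uext_ucl/uf_not => Sx; apply: nx; apply/uext_ucl.
by have [i []] := uf_meet nx Sx.
Qed.

Lemma uext_comp (T U : Type) (S : I -> set U) (a : I -> T -> U)
    (x : ultrapower F T) :
  uext (ucl F S) (uapp (ucl F a) x) <->
  uext (ucl F (fun i => [set t | S i (a i t)])) x.
Proof.
by elim/uclW: x => x; rewrite uapp_ucl; split=> /uext_ucl h; apply/uext_ucl.
Qed.

Lemma filter_forall_lt (n : nat) (P : nat -> set I) :
  (forall j, (j < n)%N -> uf_sets F (P j)) ->
  uf_sets F [set i | forall j, (j < n)%N -> P j i].
Proof.
elim: n => [|n IHn] HP; first by apply: filterE.
apply: filterS2 (IHn (fun j jn => HP j (ltnW jn))) (HP n (ltnSn n)) => i /= Pn Pi j.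
by rewrite ltnS leq_eqVlt => /orP[/eqP->//|/Pn].
Qed.

Lemma unat_ucl (T : comNzRingType) (n : nat) :
  n%:R = ucl F (fun=> n%:R : T).
Proof.
elim: n => [//|n IHn]; rewrite -natr1 IHn uadd_ucl.
by apply/uclP/filterE => i /=; rewrite natr1.
Qed.

(** Common to L and L', which differ only in mesh [dl] and bound [B]: a hyperinteger z is a choice
    of integers in the fibres, where [gridP] applies. *)
Lemma lattice_uext (R : realType) (dl B : I -> R) (M : I -> nat)
    (x : ultrapower F R) :
  uf_sets F [set i | 0 < dl i /\ dl i * (M i)%:R = B i] ->
  (exists z : ultrapower F int,
     x = ucl F dl * hR R z /\ - ucl F B <= x < ucl F B) <->
  uext (ucl F (fun i => grid (dl i) (M i))) x.
Proof.
elim/uclW: x => x FB; split.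
  move=> [z]; elim/uclW: z => z; rewrite /hR umapE umul_ucl uopp_ucl.
  move=> [/uclP xz /andP[/ule_ucl lo /ult_ucl hi]]; apply/uext_ucl.
  apply: filterS2 (filterI xz FB) (filterI lo hi) => i /= [xi [d0 dB]] [li ui].
  by apply/gridP => //; exists (z i); rewrite dB li ui.
move=> /uext_ucl xg.
have /choice[z zP] i : exists z : int, 0 < dl i -> grid (dl i) (M i) (x i) ->
    x i = dl i * z%:~R /\ - (dl i * (M i)%:R) <= x i < dl i * (M i)%:R.
  have [d0|nd0] := pselect (0 < dl i); last by exists 0.
  have [/(gridP _ _ d0)[z zx]|ng] := pselect (grid (dl i) (M i) (x i)).
    by exists z.
  by exists 0.
exists (ucl F z); rewrite /hR umapE umul_ucl uopp_ucl; split.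
  by apply/uclP; apply: filterS2 FB xg => i /= [d0 _] /(zP _ d0)[].
apply/andP; split; [apply/ule_ucl|apply/ult_ucl];
  apply: filterS2 FB xg => i /= [d0 dB] /(zP _ d0)[_]; rewrite dB.
  by move=> /andP[].
by move=> /andP[].
Qed.

End InternalSets.

(** * The double ultrapower and its two standard parts *)

Section Doubling.
Variables (I1 I2 : Type) (F1 : ultrafilter I1) (F2 : ultrafilter I2).

Lemma ustar_set_uext (T : Type) (S : I2 -> set T) :
  uf_sets F2 [set m | S m !=set0] ->
  ustar_set F1 (uext (ucl F2 S)) =
  uext (ucl (uprod F1 F2) (fun p => S p.2)).
Proof.
move=> S0; apply/seteqP; split=> x.
  move=> [f [-> fS]]; apply/uext_ucl.
  have FS : uf_sets F2 [set m | forall l, S m (f (l, m))].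
    apply: (@uf_forall _ F2 _ (fun m l => S m (f (l, m)))) => l.
    exact/uext_ucl.
  by apply: filterS FS => m /= Sm; apply: filterE.
elim/uclW: x => g /uext_ucl gS.
have [m0 [t0 _]] := filter_ex S0.
have /choice[s sS] m : exists t, S m !=set0 -> S m t.
  by have [[t St]|nS] := pselect (S m !=set0); [exists t|exists t0].
(* [g] lies in [S] only almost everywhere, whereas membership in [ustar_set] tests every internal l;
   outside the good set the value is replaced by a chosen point of [S]. *)
pose f p := if `[< S p.2 (g p) >] then g p else s p.2.
exists f; split.
  apply/uclP; apply: filterS gS => p /= Sp.
  by rewrite /f; case: asboolP.
move=> l; apply/uext_ucl; apply: filterS S0 => m /= Sm.
by rewrite /f /=; case: asboolP => // _; apply: sS.
Qed.

Lemma uprodP (A : set (I1 * I2)) :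
  uf_sets (uprod F1 F2) A <-> uf_sets F2 [set m | uf_sets F1 [set l | A (l, m)]].
Proof. by []. Qed.

Lemma dstdE (T : Type) (t : T) : dstd F1 F2 t = ucl (uprod F1 F2) (fun=> t).
Proof. exact: ustar_ucl. Qed.

Variable R : realType.
Variables (C : I1 * I2 -> R[i]) (p : I2 -> R[i]).
Hypothesis Cp : uf_sets F2 [set m | forall d : R, 0 < d ->
  uf_sets F1 [set l | normc (C (l, m) - p m) < d]].

(** A positive infinitesimal-scale test [d] is a positive real [d m] in almost every fibre, and [Cp]
    grants all tolerances there at once. Two limits would contradict each other at half their
    distance. *)
Lemma st_ucl : star_bounded (ucl (uprod F1 F2) C) /\
  st (ucl (uprod F1 F2) C) = ucl F2 p.
Proof.
split.
  exists (ucl F2 (fun m => normc (p m) + 1)).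
  rewrite ustar_ucl /hnormc umapE; apply/ule_ucl/uprodP.
  apply: filterS Cp => m /= /(_ 1 ltr01); apply: filterS => l /= h.
  have -> : C (l, m) = p m + (C (l, m) - p m) by rewrite addrC subrK.
  by apply: le_trans (normcD _ _) _; rewrite lerD2l ltW.
apply: xget_unique.
  elim/uclW => d /ult_ucl d0.
  rewrite !ustar_ucl usub_ucl /hnormc umapE; apply/ult_ucl/uprodP.
  by apply: filterS2 d0 Cp => m /= dm; apply.
elim/uclW => q /= qP; apply/uclP; apply: contrapT => /uf_not nqp.
pose d m := normc (p m - q m) / 2.
have d0 : uf_sets F2 [set m | 0 < d m].
  apply: filterS nqp => m /= nqp; rewrite divr_gt0// lt_neqAle normc_ge0 andbT.
  apply/eqP => /esym/eq0_normc/eqP; rewrite subr_eq0 => /eqP pq.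
  exact: nqp.
have := qP (ucl F2 d).
rewrite !ustar_ucl usub_ucl /hnormc umapE => /(_ _)/ult_ucl/uprodP qd.
have {}qd : uf_sets F2 [set m |
    uf_sets F1 [set l | normc (C (l, m) - q m) < d m]].
  by apply: qd; apply/ult_ucl.
have [m [/= [dm /(_ _ dm) Cm] qm]] := uf_meet (filterI d0 Cp) qd.
have [l /= [h1 h2]] := uf_meet Cm qm.
have : normc (p m - q m) < d m + d m.
  have -> : p m - q m = (C (l, m) - q m) - (C (l, m) - p m) by ring.
  by apply: le_lt_trans (normcB _ _) _; apply: ltrD.
by rewrite /d -splitr ltxx.
Qed.

Hypothesis p0 : uf_sets F2 [set m | p m != 0].

(** The tolerance in a fibre may depend on m, so d |p m| is allowed; hence the quotient is near 1
    even when [p] is infinite or infinitesimal. *)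
Lemma bst_ucl : let x := ucl (uprod F1 F2) C / ustar F1 (ucl F2 p) in
  std_bounded x /\ bst x = 1.
Proof.
rewrite /= ustar_ucl uinv_ucl umul_ucl.
have near1 (d : R) : 0 < d -> uf_sets (uprod F1 F2)
    [set k | normc (C k / p k.2 - 1) < d].
  move=> d0; apply/uprodP; apply: filterS2 p0 Cp => m /= pm Cm.
  have pm0 : 0 < normc (p m).
    rewrite lt_neqAle normc_ge0 andbT eq_sym.
    by apply: contra pm => /eqP/eq0_normc->.
  have := Cm (d * normc (p m)); rewrite mulr_gt0// => /(_ isT).
  apply: filterS => l /= h.
  have -> : C (l, m) / p m - 1 = (C (l, m) - p m) / p m.
    by rewrite mulrBl divff.
  by rewrite normcM normcV ltr_pdivrMr.
split.
  exists 2; rewrite dstdE /hnormc umapE; apply/ule_ucl.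
  apply: filterS (near1 1 ltr01) => k /= h.
  have -> : C k / p k.2 = 1 + (C k / p k.2 - 1) by rewrite addrC subrK.
  by apply: le_trans (normcD _ _) _; rewrite normc1; lra.
apply: xget_unique.
  move=> d d0; rewrite !dstdE usub_ucl /hnormc umapE; apply/ult_ucl.
  exact: near1.
move=> q /= qP; apply: contrapT => nq.
pose d := normc (1 - q) / 2.
have d0 : 0 < d.
  rewrite divr_gt0// lt_neqAle normc_ge0 andbT.
  by apply/eqP => /esym/eq0_normc/eqP; rewrite subr_eq0 => /eqP/esym.
have := qP d d0; rewrite !dstdE usub_ucl /hnormc umapE => /ult_ucl qd.
have [k /= [h1 h2]] := uf_meet (near1 d d0) qd.
have : normc (1 - q) < d + d.
  have -> : 1 - q = (C k / p k.2 - q) - (C k / p k.2 - 1) by ring.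
  by apply: le_lt_trans (normcB _ _) _; apply: ltrD.
by rewrite /d -splitr ltxx.
Qed.

End Doubling.

(** * Fibrewise description of the lattices, of X and of C *)

Section Cxi.
Variables (R : realType) (I1 I2 : Type).
Variables (F1 : ultrafilter I1) (F2 : ultrafilter I2).
Variables (h : I2 -> int) (h' : I1 * I2 -> int).

Local Notation UU := (uprod F1 F2).
Local Notation H := (ucl F2 h).
Local Notation H' := (ucl UU h').
Local Notation rh m := ((h m)%:~R : R).
Local Notation rh' p := ((h' p)%:~R : R).

(* Half the number of points of the fibres of [latL] and [latL']. *)
Definition halfL (m : I2) : nat := (`|h m| ^ 2)./2.
Definition halfL' (p : I1 * I2) : nat := (`|h p.2| * `|h' p| ^ 2)./2.

Lemma even_pos_absz (z : int) : 0 < z -> (exists k, z = 2 * k) ->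
  exists2 n : nat, z = n%:Z & ~~ odd n.
Proof.
move=> z0 [k zk]; exists `|z|%N; first by rewrite gez0_abs// ltW.
by rewrite zk abszM oddM.
Qed.

Lemma halfLE m : 0 < h m -> (exists k, h m = 2 * k) ->
  (halfL m)%:R * 2 = rh m ^+ 2 /\ (halfL m + halfL m)%:Z = h m ^+ 2.
Proof.
move=> h0 /(even_pos_absz h0)[n hn en]; rewrite /halfL hn absz_nat addnn.
rewrite even_halfK ?oddX ?negb_or//; split=> //.
by rewrite mulr_natr -mulrnA muln2 even_halfK ?oddX// natrX.
Qed.

Lemma halfL'E p : 0 < h p.2 -> (exists k, h p.2 = 2 * k) -> 0 < h' p ->
  (halfL' p)%:R * 2 = rh p.2 * rh' p ^+ 2.
Proof.
move=> h0 /(even_pos_absz h0)[n hn en] h'0; rewrite /halfL' hn absz_nat.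
have [n' ->] : exists n', h' p = n'%:Z.
  by exists `|h' p|%N; rewrite gez0_abs// ltW.
rewrite mulr_natr -mulrnA muln2 even_halfK ?oddM ?(negPf en)//.
by rewrite natrM natrX.
Qed.

Hypothesis h_even : uf_sets F2 [set m | 0 < h m /\ exists k, h m = 2 * k].
Hypothesis h'_gt0 : uf_sets UU [set p | 0 < h' p].

Lemma uprod_snd (P : I2 -> Prop) :
  uf_sets F2 [set m | P m] -> uf_sets UU [set p | P p.2].
Proof. by move=> FP; apply/uprodP; apply: filterS FP => m /= Pm; apply: filterE. Qed.

Lemma hR_ucl (J : Type) (F : ultrafilter J) (z : J -> int) :
  hR R (ucl F z) = ucl F (fun i => (z i)%:~R).
Proof. exact: umapE. Qed.

Lemma eps_ucl : eps R H = ucl F2 (fun m => (rh m)^-1).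
Proof. by rewrite /eps hR_ucl uinv_ucl. Qed.

Lemma sH_ucl : sH R F1 H = ucl UU (fun p => rh p.2).
Proof. by rewrite /sH ustar_ucl hR_ucl. Qed.

Lemma latL_uext :
  @latL R _ _ H = uext (ucl F2 (fun m => grid (rh m)^-1 (halfL m))).
Proof.
have FB : uf_sets F2 [set m | 0 < (rh m)^-1 /\
    (rh m)^-1 * (halfL m)%:R = rh m / 2].
  apply: filterS h_even => m /= [h0 hk]; rewrite invr_gt0 ltr0z; split=> //.
  have [M2 _] := halfLE h0 hk.
  have -> : (halfL m)%:R = rh m ^+ 2 / 2 by rewrite -M2 mulfK.
  by field; rewrite intr_eq0 gt_eqF.
have BE : hR R H / 2 = ucl F2 (fun m => rh m / 2).
  by rewrite hR_ucl unat_ucl uinv_ucl umul_ucl.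
apply/seteqP; split=> x; rewrite /latL /mkset eps_ucl BE.
  by move=> ?; apply/(lattice_uext _ FB).
by move=> /(lattice_uext _ FB).
Qed.

Lemma latL'_uext : @latL' R _ _ _ _ H H' =
  uext (ucl UU (fun p => grid (rh' p)^-1 (halfL' p))).
Proof.
have FB : uf_sets UU [set p | 0 < (rh' p)^-1 /\
    (rh' p)^-1 * (halfL' p)%:R = rh p.2 * (rh' p / 2)].
  apply: filterS2 (uprod_snd h_even) h'_gt0 => p /= [h0 hk] h'0.
  rewrite invr_gt0 ltr0z; split=> //.
  have -> : (halfL' p)%:R = rh p.2 * rh' p ^+ 2 / 2 by rewrite -halfL'E// mulfK.
  by field; rewrite intr_eq0 gt_eqF.
have BE : sH R F1 H * (hR R H' / 2) = ucl UU (fun p => rh p.2 * (rh' p / 2)).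
  rewrite sH_ucl hR_ucl unat_ucl uinv_ucl (umul_ucl UU (fun p => rh' p)).
  by rewrite umul_ucl.
have epsE : eps' R H' = ucl UU (fun p => (rh' p)^-1).
  by rewrite /eps' hR_ucl uinv_ucl.
apply/seteqP; split=> x; rewrite /latL' /mkset epsE BE.
  by move=> ?; apply/(lattice_uext _ FB).
by move=> /(lattice_uext _ FB).
Qed.

Lemma starL_uext : @starL R _ _ F1 _ H =
  uext (ucl UU (fun p => grid (rh p.2)^-1 (halfL p.2))).
Proof.
rewrite /starL latL_uext.
rewrite (@ustar_set_uext _ _ F1 F2 _ (fun m => grid (rh m)^-1 (halfL m)))//.
apply: filterS h_even => m /= [h0 hk].
(* The left end witnesses nonemptiness, since [halfL m] is not 0. *)
exists (gridpt (rh m)^-1 (halfL m) 0); exists 0%N => //=.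
have [_] := halfLE h0 hk; case: (halfL m) => // /eqP.
by rewrite eq_sym expf_eq0 /= gt_eqF.
Qed.

(** Both clauses of [Xset] are inclusions between internal sets, from the lattice and from its
    complement, so [uext_sub] carries them to the fibres. *)
Lemma Xset_uext : @Xset R _ _ _ _ H H' =
  uext (ucl UU (fun p => gridfuns (rh p.2)^-1 (rh' p)^-1 (halfL p.2) (halfL' p))).
Proof.
have good : uf_sets UU [set p | (rh p.2)^-1 != 0].
  apply: filterS (uprod_snd h_even) => p /= [h0 _].
  by rewrite invr_eq0 intr_eq0 gt_eqF.
apply/seteqP; split=> a; rewrite /Xset /mkset starL_uext latL'_uext.
  elim/uclW: a => a [aL a0]; apply/uext_ucl.
  have {}aL : uf_sets UU [set p | forall t, grid (rh p.2)^-1 (halfL p.2) t ->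
      grid (rh' p)^-1 (halfL' p) (a p t)].
    apply/(@uext_sub _ UU _ (fun p => grid (rh p.2)^-1 (halfL p.2))
      (fun p => [set t | grid (rh' p)^-1 (halfL' p) (a p t)])).
    by move=> k /aL /uext_comp.
  have {}a0 : uf_sets UU [set p | forall t, ~ grid (rh p.2)^-1 (halfL p.2) t ->
      a p t = 0].
    apply/(@uext_sub _ UU _ (fun p => ~` grid (rh p.2)^-1 (halfL p.2))
      (fun p => [set t | a p t = 0])).
    move=> k /uext_setC /a0; elim/uclW: k => k; rewrite uapp_ucl => /uclP.
    by move=> ak; apply/uext_ucl.
  by apply: filterS3 good aL a0 => p /= ? ? ?; apply/gridfunsP.
elim/uclW: a => a /uext_ucl ag; split=> k.
  elim/uclW: k => k /uext_ucl kL; apply/uext_comp/uext_ucl.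
  apply: filterS3 good ag kL => p /= d0 /(gridfunsP _ _ _ d0)[h1 _].
  exact: h1.
elim/uclW: k => k /uext_setC/uext_ucl kL; rewrite uapp_ucl; apply/uclP.
apply: filterS3 good ag kL => p /= d0 /(gridfunsP _ _ _ d0)[_ h1].
exact: h1.
Qed.

(** By [hsumE] it suffices to exhibit representatives of the index sets and summands, for the inner
    sum inside the outer one. *)
Lemma Cxi_ucl (xi : R[i]) (b : I1 * I2 -> R -> R) :
  Cxi H H' xi (ucl UU b) =
  ucl UU (fun p => fibre_C xi (rh p.2) (rh' p) (halfL p.2) (halfL' p) (b p)).
Proof.
apply: hsumE.
exists (fun p => gridfuns (rh p.2)^-1 (rh' p)^-1 (halfL p.2) (halfL' p)).
exists (fun p a => ((rh p.2) `^ (- (rh p.2 ^+ 2) / 2) *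
     (rh' p) `^ (- rh p.2 ^+ 2))%:C%C *
    cexp (- (pi%:C%C * ((rh p.2)^-1)%:C%C * xi *
      (\sum_(k \in grid (rh p.2)^-1 (halfL p.2))
         ((a k)%:C%C + 'i%C * xi^-1 * (b p k)%:C%C) ^+ 2)))).
split=> [p| |a _|//]; first exact: finite_gridfuns.
  exact: Xset_uext.
elim/uclW: a => a.
rewrite (@hsumE _ UU _ _ _ _ (ucl UU (fun p =>
  \sum_(k \in grid (rh p.2)^-1 (halfL p.2))
         ((a p k)%:C%C + 'i%C * xi^-1 * (b p k)%:C%C) ^+ 2))); last first.
  exists (fun p => grid (rh p.2)^-1 (halfL p.2)).
  exists (fun p k => ((a p k)%:C%C + 'i%C * xi^-1 * (b p k)%:C%C) ^+ 2).
  split=> [p| |k _|//]; first exact: finite_grid.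
    exact: starL_uext.
  elim/uclW: k => k; rewrite !uapp_ucl /hC !umapE dstdE umul_ucl uadd_ucl.
  by rewrite uexp_ucl.
have -> : eps0 R H H' = ucl UU (fun p =>
    (rh p.2) `^ (- (rh p.2 ^+ 2) / 2) * (rh' p) `^ (- rh p.2 ^+ 2)).
  rewrite /eps0 /hpowR sH_ucl uexp_ucl uopp_ucl unat_ucl uinv_ucl hR_ucl.
  rewrite (umul_ucl UU (fun p => - rh p.2 ^+ 2)).
  rewrite (umap2E _ _ (fun p => rh p.2)) (umap2E _ _ (fun p => rh' p)).
  by rewrite umul_ucl.
rewrite !dstdE eps_ucl ustar_ucl /hC !umapE.
rewrite (umul_ucl UU (fun=> pi%:C%C)).
rewrite (umul_ucl UU (fun p => pi%:C%C * ((rh p.2)^-1)%:C%C)).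
rewrite (umul_ucl UU (fun p => pi%:C%C * ((rh p.2)^-1)%:C%C * xi)).
by rewrite uopp_ucl /hcexp umapE umul_ucl uapp_ucl.
Qed.

End Cxi.

Theorem theorem3p2 (R : realType) (I1 I2 : Type)
    (I1_infinite : infinite_set [set: I1])
    (I2_infinite : infinite_set [set: I2])
    (F1 : ultrafilter I1) (F2 : ultrafilter I2)
    (F1_nonprincipal : nonprincipal F1) (F2_nonprincipal : nonprincipal F2)
    (H : ultrapower F2 int)
    (H_gt0 : 0 < H)
    (H_even : exists m : ultrapower F2 int, H = 2 * m)
    (H_infinite : forall n : int, ucst F2 n < H)
    (H' : ultrapower (uprod F1 F2) int)
    (H'_gt0 : 0 < H')
    (H'_even : exists m : ultrapower (uprod F1 F2) int, H' = 2 * m)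
    (H'_infinite : forall z : ultrapower F2 int, ustar F1 z < H')
    (xi : R[i]) (xi_gt0 : 0 < complex.Re xi)
    (b : ultrapower (uprod F1 F2) (R -> R))
    (bX : Xset H H' b)
    (b_bounded : exists b0 : ultrapower F2 R,
       forall k, latL H k -> `|uapp b (ustar F1 k)| <= ustar F1 b0) :
  let C := Cxi H H' xi b in
  let p := hexprz (ucst F2 (1 / sqrtc xi)) (H ^+ 2) in
  (star_bounded C /\ st C = p) /\
  (std_bounded (C / ustar F1 p) /\ bst (C / ustar F1 p) = 1).
Proof.
move=> C p; rewrite {}/C {}/p.
move: H'_gt0 H'_even H'_infinite bX b_bounded.
elim/uclW: H H_gt0 H_even H_infinite => h H_gt0 [k0] H_even _.
elim/uclW: H' => h' H'_gt0' _ H'_inf; elim/uclW: b => b _ [].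
elim/uclW => b0 b_bd.
have h_even : uf_sets F2 [set m | 0 < h m /\ exists k, h m = 2 * k].
  move: H_even; elim/uclW: k0 => k; rewrite mulr_natl mulr2n uadd_ucl => /uclP hk.
  move/ult_ucl: H_gt0; apply: filterS2 hk => m /= hk h0; split=> //.
  by exists (k m); rewrite mulr_natl mulr2n.
have h'_gt0 : uf_sets (uprod F1 F2) [set q | 0 < h' q] by apply/ult_ucl.
(* That [H'] exceeds every image from the first ultrapower means that in almost every fibre h' tends
   to infinity along F1. *)
have h'_inf : uf_sets F2 [set m | forall n : int,
    uf_sets F1 [set l | n < h' (l, m)]].
  apply: (@uf_forall _ F2 _ (fun m n => uf_sets F1 [set l | n < h' (l, m)])) => z.
  by have := H'_inf (ucl F2 z); rewrite ustar_ucl => /ult_ucl.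
have {}b_bd : uf_sets F2 [set m | uf_sets F1 [set l |
    forall k, grid ((h m)%:~R)^-1 (halfL h m) k -> `|b (l, m) k| <= b0 m]].
  have : uf_sets F2 [set m | forall k, grid ((h m)%:~R)^-1 (halfL h m) k ->
      uf_sets F1 [set l | `|b (l, m) k| <= b0 m]].
    apply: (@uf_forall _ F2 _ (fun m k => grid ((h m)%:~R)^-1 (halfL h m) k ->
      uf_sets F1 [set l | `|b (l, m) k| <= b0 m])) => k.
    have [kL|/uf_not nkL] := pselect (uf_sets F2
      [set m | grid ((h m)%:~R)^-1 (halfL h m) (k m)]); last first.
      by apply: filterS nkL => m /=.
    have := b_bd (ucl F2 k); rewrite (latL_uext _ h_even) => bk.
    have {bk} := bk (iffRL (uext_ucl _ _ _) kL).
    rewrite ustar_ucl uapp_ucl unorm_ucl ustar_ucl => /ule_ucl/uprodP.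
    by apply: filterS => m /= Fm _.
  apply: filterS => m /= bk.
  set dl := _^-1 in bk *; set M := halfL h m in bk *.
  (* The bound holds F1-almost everywhere at each point; the grid of a fixed fibre is finite, so the
     quantifier over points can enter the filter. *)
  have /(filter_forall_lt (n := M + M)) : forall j, (j < M + M)%N ->
      uf_sets F1 [set l | `|b (l, m) (gridpt dl M j)| <= b0 m].
    by move=> j jM; apply: bk; exists j.
  by apply: filterS => l /= bl _ [j /= jM <-]; apply: bl.
have hp : hexprz (ucst F2 (1 / sqrtc xi)) (ucl F2 h ^+ 2) =
    ucl F2 (fun m => (1 / sqrtc xi) ^+ (halfL h m + halfL h m)).
  rewrite uexp_ucl /hexprz umap2E; apply/uclP; apply: filterS h_even => m /=.
  by move=> [h0 hk]; have [_ <-] := halfLE R h0 hk.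
rewrite Cxi_ucl// hp.
have Clim : uf_sets F2 [set m | forall d : R, 0 < d -> uf_sets F1 [set l |
   normc (fibre_C xi (h m)%:~R (h' (l, m))%:~R (halfL h m) (halfL' h h' (l, m))
     (b (l, m)) - (1 / sqrtc xi) ^+ (halfL h m + halfL h m)) < d]].
  apply: filterS3 (filterI h_even h'_gt0) h'_inf b_bd.
  move=> m /= [[h0 hk] h'0] hinf bb d d0.
  have [M2 _] := halfLE R h0 hk.
  have rh0 : 0 < (h m)%:~R :> R by rewrite ltr0z.
  have [T HT] := fibre_C_limit (b0 m) xi_gt0 rh0 M2 d0.
  (* The threshold [T] depends on the fibre m only, so the divergence of h' along F1 passes it. *)
  have := hinf (Num.ceil T).
  apply: filterS3 h'0 bb => l /= h'0 bl Tl; apply: HT => //.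
  - by rewrite ltr0z.
  - by apply: le_lt_trans (ceil_ge T) _; rewrite ltr_int.
  - exact: halfL'E.
have p0 : uf_sets F2 [set m | (1 / sqrtc xi) ^+ (halfL h m + halfL h m) != 0].
  apply: filterE => m /=; rewrite expf_neq0// div1r invr_eq0 sqrtc_eq0.
  by apply/eqP => xi0; move: xi_gt0; rewrite xi0 ltxx.
split; first exact: (@st_ucl _ _ F1 F2 R (fun q => fibre_C xi (h q.2)%:~R
  (h' q)%:~R (halfL h q.2) (halfL' h h' q) (b q)) _ Clim).
exact: (@bst_ucl _ _ F1 F2 R (fun q => fibre_C xi (h q.2)%:~R
  (h' q)%:~R (halfL h q.2) (halfL' h h' q) (b q)) _ Clim p0).
Qed.
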